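(* In the partial order of $\Sigma^0_2$ enumeration degrees (all variables below range over $\Sigma^0_2$ sets), the following statements hold. (1) For all $A_0,B_0,A_1,B_1$ there exists $Z$ such that: if $B_0\le_e A_1$, $A_0\not\le_e B_0$ and $A_1\not\le_e B_1$, then either ($Z<_e A_0$ and $Z\not\le_e B_0$) or ($Z<_e A_1$ and $Z\not\le_e B_1$). (2) For all natural numbers $n,m$ and all $\hat A,A,B_0,\dots,B_n,C_0,\dots,C_m$ there exists $Z$ such that: if $\hat A\le_e A$, $\hat A\le_e B_0$, $\hat A\not\le_e B_i$ for all $i\ne0$, and $A,B_0,\dots,B_n,C_0,\dots,C_m$ are pairwise $\le_e$-incomparable, then either ($Z<_e A$ and $Z\not\le_e B_i$ for every $i\le n$) or ($Z<_e B_0$ and $Z\not\le_e C_i$ for every $i\le m$). (3) For all $A,B,C,D_0,D_1$ there exists $Z$ such that: if $A,B,C$ are pairwise $\le_e$-incomparable, $D_0<_e A$, $D_0<_e B$, $D_1<_e B$ and $D_1<_e C$, then either ($D_0<_e Z<_e A$ and $Z\not\le_e B$) or ($D_1<_e Z<_e B$ and $Z\not\le_e C$).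
   Context: $\le_e$ is enumeration reducibility: $A\le_e B$ iff $A=\Gamma(B):=\{x:\exists\text{ finite }D\subseteq B,\ \langle x,D\rangle\in\Gamma\}$ for some c.e. set $\Gamma$; $<_e$ as usual. $\Sigma^0_2$ sets are exactly the sets $\le_e 0'_e$, the enumeration jump of $\emptyset$. *)

(* Defs.v *)
From Stdlib Require Import Arith List.
From Stdlib Require Cantor.
Import ListNotations.

Definition nset := nat -> Prop.

(** Partial recursive functions, as Kleene's mu-recursive functions in unary
    form: tuples of arguments are coded by the Cantor pairing bijection. *)
Inductive code : Type :=
| Zero : code
| Succ : code
| Left : code
| Right : code
| Pair : code -> code -> code
| Comp : code -> code -> code
| Prec : code -> code -> code
| Mu : code -> code.

(** [eval c x y]: the partial function coded by [c] is defined at [x], with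
    value [y].  [Prec f g] is h with h<a,0> = f a and
    h<a,n+1> = g<a,<n,h<a,n>>>; [Mu f] maps a to the least n with f<a,n> = 0,
    f<a,m> being defined and nonzero for every m < n. *)
Fixpoint eval (c : code) (x y : nat) {struct c} : Prop :=
  match c with
  | Zero => y = 0
  | Succ => y = S x
  | Left => y = fst (Cantor.of_nat x)
  | Right => y = snd (Cantor.of_nat x)
  | Pair f g =>
      exists a b, eval f x a /\ eval g x b /\ y = Cantor.to_nat (a, b)
  | Comp f g => exists z, eval g x z /\ eval f z y
  | Prec f g =>
      let (a, n) := Cantor.of_nat x in
      nat_rect (fun _ => nat -> Prop)
        (fun s => eval f a s)
        (fun m h s =>
           exists r, h r /\ eval g (Cantor.to_nat (a, Cantor.to_nat (m, r))) s)
        n y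
  | Mu f =>
      eval f (Cantor.to_nat (x, y)) 0 /\
      forall m, m < y -> exists k, eval f (Cantor.to_nat (x, m)) (S k)
  end.

Definition ce (W : nset) : Prop :=
  exists c, forall x, W x <-> exists y, eval c x y.

Definition computable (R : nset) : Prop :=
  exists c, forall x, (R x /\ eval c x 1) \/ (~ R x /\ eval c x 0).

Definition Sigma02 (A : nset) : Prop :=
  exists R : nset, computable R /\
    forall x, A x <->
      exists a, forall b, R (Cantor.to_nat (x, Cantor.to_nat (a, b))).

(** Finite sets are given by canonical (strong) indices: [u] codes the set of
    the positions of the binary digits 1 of [u]. *)
Definition fin_set (u : nat) : nset := fun i => Nat.testbit u i = true.

Definition enum_op (G B : nset) : nset := fun x =>
  exists u, (forall i, fin_set u i -> B i) /\ G (Cantor.to_nat (x, u)).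

Definition e_le (A B : nset) : Prop :=
  exists G, ce G /\ forall x, A x <-> enum_op G B x.

Notation "A ≤ₑ B" := (e_le A B) (at level 70, no associativity).

Definition e_lt (A B : nset) : Prop := A ≤ₑ B /\ ~ B ≤ₑ A.

Notation "A <ₑ B" := (e_lt A B) (at level 70, no associativity).

Definition e_incomparable (A B : nset) : Prop := ~ A ≤ₑ B /\ ~ B ≤ₑ A.

Definition pairwise_incomparable (l : list nset) : Prop :=
  ForallOrdPairs e_incomparable l.

(** The list F 0, ..., F n; it has n + 1 entries. *)
Definition upto (F : nat -> nset) (n : nat) : list nset :=
  map F (seq 0 (S n)).

(* Main.v *)
Require Import Defs.
From Stdlib Require Import Arith List Lia Classical.
From Stdlib Require Cantor.
Import ListNotations.

(** Call [(A, B)] an Ahmad pair above [D] if [D ≤ₑ A], [D ≤ₑ B], [A ≰ₑ B], and every [Z] with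
    [D ≤ₑ Z ≤ₑ A] satisfies [A ≤ₑ Z] or [Z ≤ₑ B].  Each of the three claims reduces to the fact that
    [B0 ≰ₑ A1] whenever [(A0, B0)] and [(A1, B1)] are Ahmad pairs of [Σ⁰₂] sets.

    Let [S e] be [∃ k ∀ b, X(e, k, b)] with [X ≤ₑ A].  A Gutteridge-style construction yields sets
    [Z_e], uniformly below [A], that lie above [D] and compute [A] iff [S e]: column [k] of [Z_e]
    copies [A] as long as [X(e, k, 0), X(e, k, 1), ...] hold, and a finite part of the column is
    dumped in order to diagonalize.  If [(A, B)] is an Ahmad pair above [D], then [~ S e] iff [Z_e]
    is the image of [B] under some enumeration operator.

    This makes [~ S] a [Σ⁰₄] predicate.  On the other hand, the sets below [A] turn out to be [Π₂]
    over the positive information on [B], so that, with [X] c.e., every [Π⁰₃] and hence every [Σ⁰₄]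
    predicate is of the form [∃ k ∀ b, Y(e, k, b)] with [Y ≤ₑ B].  If [B0 ≤ₑ A1], the two facts for
    [(A0, B0)] and [(A1, B1)] make the complement of every [Σ⁰₄] predicate [Σ⁰₄]. *)

Notation "⟨ x , y ⟩" := (Cantor.to_nat (x, y)) (at level 0, format "⟨ x ,  y ⟩").
Notation π1 z := (fst (Cantor.of_nat z)).
Notation π2 z := (snd (Cantor.of_nat z)).

Lemma pair_π1 x y : π1 ⟨x, y⟩ = x.
Proof. now rewrite Cantor.cancel_of_to. Qed.

Lemma pair_π2 x y : π2 ⟨x, y⟩ = y.
Proof. now rewrite Cantor.cancel_of_to. Qed.

Lemma pair_eta z : ⟨π1 z, π2 z⟩ = z.
Proof. rewrite <- surjective_pairing. apply Cantor.cancel_to_of. Qed.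

Lemma pair_le x y : x <= ⟨x, y⟩ /\ y <= ⟨x, y⟩.
Proof. pose proof (Cantor.to_nat_non_decreasing x y). lia. Qed.

#[local] Opaque Cantor.to_nat Cantor.of_nat.

Ltac simp_pair := repeat (rewrite ?pair_π1, ?pair_π2 in *).

Lemma curry_iff (P : nat -> nset) (Q : nset) :
  (forall z, P (π1 z) (π2 z) <-> Q z) -> forall x y, P x y <-> Q ⟨x, y⟩.
Proof. intros H x y. specialize (H ⟨x, y⟩). now simp_pair. Qed.

(** * Bounded sets and canonical indices *)

Lemma least_witness (P : nset) : (exists n, P n) -> exists n, P n /\ forall m, m < n -> ~ P m.
Proof.
  intro H.
  destruct (dec_inh_nat_subset_has_unique_least_element P (fun n => classic (P n)) H)
    as [n [[Pn least] _]].
  exists n. split; [exact Pn |]. intros m lt_mn Pm. apply least in Pm. lia.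
Qed.

Definition bounded (P : nset) : Prop := exists n, forall x, P x -> x < n.

Lemma bounded_incl (P Q : nset) : (forall x, P x -> Q x) -> bounded Q -> bounded P.
Proof. intros PQ [n Hn]. exists n. auto. Qed.

Lemma bounded_lt n : bounded (fun x => x < n).
Proof. now exists n. Qed.

Lemma bounded_eq n : bounded (fun x => x = n).
Proof. exists (S n). intros x ->. lia. Qed.

Lemma bounded_collection (I : nset) (P : nat -> nset) :
  bounded I -> (forall i, I i -> exists y, P i y) ->
  exists b, forall i, I i -> exists y, y < b /\ P i y.
Proof.
  intros [n Hn] H.
  assert (below : forall m, exists b, forall i, i < m -> I i -> exists y, y < b /\ P i y).
  { induction m as [|m [b Hb]]; [exists 0; lia |].
    destruct (classic (I m)) as [Im|nIm].
    - destruct (H m Im) as [y Py]. exists (S (b + y)). intros i lt Ii.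
      destruct (Nat.eq_dec i m) as [->|]; [exists y; split; [lia | exact Py] |].
      destruct (Hb i ltac:(lia) Ii) as [y' [lt' Py']]. exists y'. split; [lia | exact Py'].
    - exists b. intros i lt Ii. apply Hb; [| exact Ii].
      destruct (Nat.eq_dec i m) as [->|]; [contradiction | lia]. }
  destruct (below n) as [b Hb]. exists b. auto.
Qed.

Lemma bounded_or (P Q : nset) : bounded P -> bounded Q -> bounded (fun x => P x \/ Q x).
Proof.
  intros [n Hn] [m Hm]. exists (n + m).
  intros x [Px|Qx]; [apply Hn in Px | apply Hm in Qx]; lia.
Qed.

Lemma bounded_union (I : nset) (P : nat -> nset) :
  bounded I -> (forall i, I i -> bounded (P i)) -> bounded (fun x => exists i, I i /\ P i x).
Proof.
  intros bounded_I HP.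
  destruct (bounded_collection I (fun i b => forall x, P i x -> x < b) bounded_I HP) as [b Hb].
  exists b. intros x [i [Ii Px]]. destruct (Hb i Ii) as [b' [lt_b'b Hb']].
  specialize (Hb' x Px). lia.
Qed.

Lemma bounded_pairs c (P : nat -> nset) :
  (forall k, k < c -> bounded (P k)) -> bounded (fun z => π1 z < c /\ P (π1 z) (π2 z)).
Proof.
  intro HP.
  apply bounded_incl with (fun z => exists k, k < c /\ exists y, P k y /\ z = ⟨k, y⟩).
  - intros z [lt Pz]. exists (π1 z). split; [exact lt |]. exists (π2 z). now rewrite pair_eta.
  - apply bounded_union; [apply bounded_lt |]. intros k lt.
    apply bounded_union; [now apply HP | intros; apply bounded_eq].
Qed.

Lemma bounded_initial (P : nset) : (exists n, ~ P n) -> bounded (fun x => forall m, m < x -> P m).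
Proof.
  intros [n nPn]. exists (S n). intros x Hx.
  destruct (Nat.lt_ge_cases x (S n)); [assumption |]. now destruct (nPn (Hx n ltac:(lia))).
Qed.

Notation "u ⊆ P" := (forall i, fin_set u i -> P i) (at level 70, no associativity).

Lemma fin_set_lt u : u ⊆ (fun i => i < u).
Proof.
  intros i Hi. destruct (Nat.lt_ge_cases i u) as [|le_ui]; [assumption |].
  unfold fin_set in Hi. rewrite Nat.testbit_eqb, Nat.div_small in Hi; [discriminate |].
  apply Nat.le_lt_trans with i; [assumption | apply Nat.pow_gt_lin_r; lia].
Qed.

Lemma bounded_fin_set u : bounded (fin_set u).
Proof. exists u. apply fin_set_lt. Qed.

Lemma fin_set_0 P : 0 ⊆ P.
Proof. intros i Hi. apply fin_set_lt in Hi. lia. Qed.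

Lemma fin_set_bounded P : bounded P -> exists u, forall i, fin_set u i <-> P i.
Proof.
  intros [n Hn]. revert P Hn. induction n as [|n IH]; intros P Hn.
  - exists 0. intro i. split; [apply fin_set_0 | intro Pi; apply Hn in Pi; lia].
  - destruct (IH (fun i => i < n /\ P i)) as [u Hu]; [tauto |].
    destruct (classic (P n)) as [Pn|nPn].
    + exists (Nat.lor u (2 ^ n)). intro i. unfold fin_set in *.
      rewrite Nat.lor_spec, Bool.orb_true_iff, Hu, Nat.pow2_bits_eqb, Nat.eqb_eq. split.
      * now intros [[_ Pi]| <-].
      * intro Pi. specialize (Hn i Pi). destruct (Nat.eq_dec i n); [auto |].
        left. split; [lia | exact Pi].
    + exists u. intro i. rewrite Hu. split; [tauto |].
      intro Pi. split; [| exact Pi]. specialize (Hn i Pi).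
      destruct (Nat.eq_dec i n) as [->|]; [contradiction | lia].
Qed.

Lemma bounded_powerset P : bounded P -> bounded (fun u => u ⊆ P).
Proof.
  intros [n Hn]. exists (2 ^ n). intros u uP. destruct (Nat.eq_dec u 0) as [->|u_neq0].
  - pose proof (Nat.pow_nonzero 2 n). lia.
  - apply Nat.log2_lt_pow2; [lia |]. apply Hn, uP, Nat.bit_log2, u_neq0.
Qed.

(** * Total recursive functions *)

Definition recursive (f : nat -> nat) : Prop := exists c, forall x, eval c x (f x).

Lemma recursive_ext f g : (forall x, f x = g x) -> recursive f -> recursive g.
Proof. intros fg [c Hc]. exists c. intro x. rewrite <- fg. apply Hc. Qed.

Lemma recursive_id : recursive (fun x => x).
Proof.
  exists (Pair Left Right). intro x. simpl. exists (π1 x), (π2 x). now rewrite pair_eta.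
Qed.

Lemma recursive_comp f g : recursive f -> recursive g -> recursive (fun x => f (g x)).
Proof. intros [c Hc] [d Hd]. exists (Comp c d). intro x. simpl. eauto. Qed.

Lemma recursive_succ f : recursive f -> recursive (fun x => S (f x)).
Proof. apply (recursive_comp S). now exists Succ. Qed.

Lemma recursive_const n : recursive (fun _ => n).
Proof. induction n; [now exists Zero | now apply recursive_succ]. Qed.

Lemma recursive_pair f g : recursive f -> recursive g -> recursive (fun x => ⟨f x, g x⟩).
Proof. intros [c Hc] [d Hd]. exists (Pair c d). intro x. simpl. eauto 6. Qed.

Lemma recursive_π1 f : recursive f -> recursive (fun x => π1 (f x)).
Proof. apply (recursive_comp (fun x => π1 x)). now exists Left. Qed.

Lemma recursive_π2 f : recursive f -> recursive (fun x => π2 (f x)).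
Proof. apply (recursive_comp (fun x => π2 x)). now exists Right. Qed.

Lemma recursive_nat_rect f g h :
  recursive f -> recursive (fun z => g (π1 z) (π1 (π2 z)) (π2 (π2 z))) -> recursive h ->
  recursive (fun x => nat_rect (fun _ => nat) (f x) (g x) (h x)).
Proof.
  intros [cf Hf] [cg Hg] Hh.
  apply recursive_ext with
    (fun x => (fun z => nat_rect (fun _ => nat) (f (π1 z)) (g (π1 z)) (π2 z)) ⟨x, h x⟩).
  { intro x. simpl. now simp_pair. }
  apply (recursive_comp (fun z => nat_rect (fun _ => nat) (f (π1 z)) (g (π1 z)) (π2 z)));
    [| now apply recursive_pair; [apply recursive_id |]].
  exists (Prec cf cg). intro z. simpl. destruct (Cantor.of_nat z) as [a n]. simpl.
  induction n as [|n IH]; simpl.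
  - apply Hf.
  - eexists. split; [exact IH |].
    specialize (Hg ⟨a, ⟨n, nat_rect (fun _ => nat) (f a) (g a) n⟩⟩). now simp_pair.
Qed.

Ltac recursive_step :=
  lazymatch goal with
  | |- recursive (fun z => Cantor.to_nat (@?f z, @?g z)) => apply (recursive_pair f g)
  | |- recursive (fun z => fst (Cantor.of_nat (@?f z))) => apply (recursive_π1 f)
  | |- recursive (fun z => snd (Cantor.of_nat (@?f z))) => apply (recursive_π2 f)
  | |- recursive (fun z => z) => apply recursive_id
  | |- recursive (fun _ => ?c) => apply (recursive_const c)
  | |- recursive (fun z => S (@?f z)) => apply (recursive_succ f)
  | H : recursive ?f |- recursive (fun z => ?f (@?h z)) => apply (recursive_comp f h H)
  end.

Ltac recursive_tac := cbv beta; repeat (recursive_step; cbv beta).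

Lemma recursive_add f g : recursive f -> recursive g -> recursive (fun x => f x + g x).
Proof.
  intros Hf Hg.
  apply recursive_ext with (fun x => nat_rect (fun _ => nat) (f x) (fun _ r => S r) (g x)).
  - intro x. induction (g x); simpl; lia.
  - apply (recursive_nat_rect f (fun _ _ r => S r) g); recursive_tac; assumption.
Qed.

Lemma recursive_mul f g : recursive f -> recursive g -> recursive (fun x => f x * g x).
Proof.
  intros Hf Hg.
  apply recursive_ext with (fun x => nat_rect (fun _ => nat) 0 (fun _ r => r + f x) (g x)).
  - intro x. induction (g x) as [|n IH]; simpl; [lia | rewrite IH; lia].
  - apply (recursive_nat_rect (fun _ => 0) (fun x _ r => r + f x) g); recursive_tac; [| assumption].
    apply recursive_add; recursive_tac.
Qed.

Lemma recursive_pred f : recursive f -> recursive (fun x => pred (f x)).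
Proof.
  intro Hf.
  apply recursive_ext with (fun x => nat_rect (fun _ => nat) 0 (fun n _ => n) (f x)).
  - intro x. now destruct (f x).
  - apply (recursive_nat_rect (fun _ => 0) (fun _ n _ => n) f); recursive_tac; assumption.
Qed.

Lemma recursive_sub f g : recursive f -> recursive g -> recursive (fun x => f x - g x).
Proof.
  intros Hf Hg.
  apply recursive_ext with (fun x => nat_rect (fun _ => nat) (f x) (fun _ r => pred r) (g x)).
  - intro x. induction (g x) as [|n IH]; simpl; [lia | rewrite IH; lia].
  - apply (recursive_nat_rect f (fun _ _ r => pred r) g); [assumption | | assumption].
    apply recursive_pred; recursive_tac.
Qed.

Lemma recursive_pow2 f : recursive f -> recursive (fun x => 2 ^ f x).
Proof.
  intro Hf.
  apply recursive_ext with (fun x => nat_rect (fun _ => nat) 1 (fun _ r => r + r) (f x)).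
  - intro x. induction (f x) as [|n IH]; simpl; [reflexivity | rewrite IH; lia].
  - apply (recursive_nat_rect (fun _ => 1) (fun _ _ r => r + r) f); recursive_tac; [| assumption].
    apply recursive_add; recursive_tac.
Qed.

Lemma recursive_sum f n :
  recursive (fun z => f (π1 z) (π2 z)) -> recursive n ->
  recursive (fun x => nat_rect (fun _ => nat) 0 (fun i r => f x i + r) (n x)).
Proof.
  intros Hf Hn.
  apply (recursive_nat_rect (fun _ => 0) (fun x i r => f x i + r) n); recursive_tac; [| assumption].
  apply recursive_add; [| recursive_tac].
  refine (recursive_ext _ _ _ (recursive_comp _ (fun z => ⟨π1 z, π1 (π2 z)⟩) Hf _)).
  - intro z. simpl. now simp_pair.
  - recursive_tac.
Qed.

(** * Adequate pointclasses *)

Definition decidable (S : nset) : Prop := exists f, recursive f /\ forall x, S x <-> f x = 0.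

(** In the sense of Moschovakis. *)
Class Adequate (C : nset -> Prop) : Prop := {
  adequate_decidable (P : nset) : decidable P -> C P;
  adequate_ext (P Q : nset) : (forall x, P x <-> Q x) -> C P -> C Q;
  adequate_comp (P : nset) h : C P -> recursive h -> C (fun x => P (h x));
  adequate_and (P Q : nset) : C P -> C Q -> C (fun x => P x /\ Q x);
  adequate_or (P Q : nset) : C P -> C Q -> C (fun x => P x \/ Q x);
  adequate_ball (P : nat -> nset) n :
    C (fun z => P (π1 z) (π2 z)) -> recursive n -> C (fun x => forall i, i < n x -> P x i);
  adequate_bex (P : nat -> nset) n :
    C (fun z => P (π1 z) (π2 z)) -> recursive n -> C (fun x => exists i, i < n x /\ P x i)
}.

Class ExClosed (C : nset -> Prop) : Prop :=
  ex_closed (P : nat -> nset) : C (fun z => P (π1 z) (π2 z)) -> C (fun x => exists y, P x y).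

Class AllClosed (C : nset -> Prop) : Prop :=
  all_closed (P : nat -> nset) : C (fun z => P (π1 z) (π2 z)) -> C (fun x => forall y, P x y).

Lemma decidable_not P : decidable P -> decidable (fun x => ~ P x).
Proof.
  intros [f [Hf Pf]]. exists (fun x => 1 - f x). split.
  - apply recursive_sub; [apply recursive_const | exact Hf].
  - intro x. rewrite Pf. lia.
Qed.

Lemma decidable_ball (P : nat -> nset) n :
  decidable (fun z => P (π1 z) (π2 z)) -> recursive n ->
  decidable (fun x => forall i, i < n x -> P x i).
Proof.
  intros [f [Hf Pf]] Hn.
  exists (fun x => nat_rect (fun _ => nat) 0 (fun i r => f ⟨x, i⟩ + r) (n x)). split.
  - apply (recursive_sum (fun x i => f ⟨x, i⟩) n); recursive_tac; assumption.
  - intro x. induction (n x) as [|m IH]; simpl; [split; [reflexivity | lia] |].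
    rewrite Nat.eq_add_0, <- IH. specialize (Pf ⟨x, m⟩). simp_pair. rewrite <- Pf. split.
    + auto.
    + intros [Pm Plt] i lt. destruct (Nat.eq_dec i m) as [->|]; [exact Pm | apply Plt; lia].
Qed.

#[export] Instance adequate_decidable_sets : Adequate decidable.
Proof.
  assert (ext : forall P Q : nset, (forall x, P x <-> Q x) -> decidable P -> decidable Q).
  { intros P Q PQ [f [Hf Pf]]. exists f. split; [exact Hf |]. intro x. now rewrite <- PQ. }
  split; auto using decidable_ball.
  - intros P h [f [Hf Pf]] Hh. exists (fun x => f (h x)). split; [recursive_tac; exact Hh | auto].
  - intros P Q [f [Hf Pf]] [g [Hg Qg]]. exists (fun x => f x + g x).
    split; [now apply recursive_add |]. intro x. rewrite Pf, Qg. lia.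
  - intros P Q [f [Hf Pf]] [g [Hg Qg]]. exists (fun x => f x * g x).
    split; [now apply recursive_mul |]. intro x. rewrite Pf, Qg. lia.
  - intros P n HP Hn. apply (ext (fun x => ~ forall i, i < n x -> ~ P x i)).
    + intro x. split.
      * intro H. apply NNPP. intro none. apply H. eauto.
      * intros [i [lt Pi]] H. exact (H i lt Pi).
    + apply decidable_not. apply (decidable_ball (fun x i => ~ P x i)); [| exact Hn].
      now apply decidable_not.
Qed.

Lemma decidable_le f g : recursive f -> recursive g -> decidable (fun x => f x <= g x).
Proof.
  intros Hf Hg. exists (fun x => f x - g x). split; [now apply recursive_sub |]. intro x. lia.
Qed.

Lemma decidable_lt f g : recursive f -> recursive g -> decidable (fun x => f x < g x).
Proof. intros Hf Hg. apply (decidable_le (fun x => S (f x)) g); recursive_tac; assumption. Qed.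

Lemma decidable_eq f g : recursive f -> recursive g -> decidable (fun x => f x = g x).
Proof.
  intros Hf Hg. apply (adequate_ext (fun x => f x <= g x /\ g x <= f x)); [intro x; lia |].
  now apply adequate_and; apply decidable_le.
Qed.

Lemma fin_set_iff_division a i :
  fin_set a i <-> exists h, h < S a /\ exists l, l < 2 ^ i /\ a = l + (1 + 2 * h) * 2 ^ i.
Proof.
  unfold fin_set. split.
  - intro Hi. destruct (Nat.testbit_spec a i) as [l [h [[_ lt_l] E]]]. rewrite Hi in E.
    exists h. split; [| eauto]. pose proof (Nat.pow_nonzero 2 i). simpl Nat.b2n in E. nia.
  - intros [h [_ [l [lt_l E]]]]. apply (Nat.testbit_unique a i true l h); [lia | exact E].
Qed.

Lemma decidable_fin_set f g :
  recursive f -> recursive g -> decidable (fun x => fin_set (f x) (g x)).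
Proof.
  intros Hf Hg.
  apply (adequate_ext (fun x => exists h, h < S (f x) /\
    exists l, l < 2 ^ g x /\ f x = l + (1 + 2 * h) * 2 ^ g x)).
  { intro x. symmetry. apply fin_set_iff_division. }
  apply (adequate_bex (fun x h => exists l, l < 2 ^ g x /\ f x = l + (1 + 2 * h) * 2 ^ g x));
    [| recursive_tac; exact Hf].
  apply (adequate_bex (fun z l => f (π1 z) = l + (1 + 2 * π2 z) * 2 ^ g (π1 z)));
    [| apply recursive_pow2; recursive_tac].
  apply decidable_eq; [recursive_tac |].
  apply recursive_add; [recursive_tac |].
  apply recursive_mul; [| apply recursive_pow2; recursive_tac].
  apply (recursive_succ (fun z => 2 * π2 (π1 z))). apply recursive_mul; recursive_tac.
Qed.

Definition co_class (C : nset -> Prop) : nset -> Prop := fun S => C (fun x => ~ S x).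

Section AdequateTheory.

Context {C : nset -> Prop} {adequate_C : Adequate C}.

Lemma adequate_comp2 (P : nat -> nset) f g :
  C (fun z => P (π1 z) (π2 z)) -> recursive f -> recursive g -> C (fun x => P (f x) (g x)).
Proof.
  intros HP Hf Hg.
  apply (adequate_ext (fun x => P (π1 ⟨f x, g x⟩) (π2 ⟨f x, g x⟩))).
  - intro x. now simp_pair.
  - apply (adequate_comp (fun z => P (π1 z) (π2 z))); [exact HP |]. now apply recursive_pair.
Qed.

Lemma adequate_comp3 (P : nat -> nat -> nset) f g h :
  C (fun z => P (π1 z) (π1 (π2 z)) (π2 (π2 z))) -> recursive f -> recursive g -> recursive h ->
  C (fun x => P (f x) (g x) (h x)).
Proof.
  intros HP Hf Hg Hh.
  apply (adequate_ext (fun x => P (f x) (π1 ⟨g x, h x⟩) (π2 ⟨g x, h x⟩))).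
  - intro x. now simp_pair.
  - apply (adequate_comp2 (fun a z => P a (π1 z) (π2 z))); [exact HP | exact Hf |].
    now apply recursive_pair.
Qed.

Lemma adequate_section (P : nat -> nset) n : C (fun z => P (π1 z) (π2 z)) -> C (P n).
Proof. intro HP. now apply (adequate_comp2 P (fun _ => n) (fun x => x)); recursive_tac. Qed.

Lemma adequate_ball_fin_set (P : nat -> nset) u :
  C (fun z => P (π1 z) (π2 z)) -> recursive u -> C (fun x => u x ⊆ P x).
Proof.
  intros HP Hu. apply (adequate_ext (fun x => forall i, i < u x -> ~ fin_set (u x) i \/ P x i)).
  - intro x. split.
    + intros H i ui. destruct (H i); [now apply fin_set_lt | contradiction | assumption].
    + intros H i _. destruct (classic (fin_set (u x) i)); auto.
  - apply (adequate_ball (fun x i => ~ fin_set (u x) i \/ P x i)); [| exact Hu].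
    apply adequate_or; [| exact HP].
    apply adequate_decidable, decidable_not, decidable_fin_set; recursive_tac.
Qed.

Lemma adequate_iff P Q :
  C P -> co_class C P -> C Q -> co_class C Q -> C (fun x => P x <-> Q x).
Proof.
  intros HP co_P HQ co_Q.
  apply (adequate_ext (fun x => (~ P x \/ Q x) /\ (~ Q x \/ P x))); [intro x; tauto |].
  now repeat (apply adequate_and || apply adequate_or).
Qed.

End AdequateTheory.

Create HintDb pointclass.

Ltac pointclass_leaf := solve [assumption | auto with pointclass nocore].

Ltac pointclass_step :=
  match goal with
  | |- recursive _ => recursive_step
  | |- ?C (fun x => exists i, i < @?n x /\ @?P x i) => apply (adequate_bex P n)
  | |- ?C (fun x => exists y, @?P x y) => apply (ex_closed P)
  | |- ?C (fun x => @?P x /\ @?Q x) => apply (adequate_and P Q)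
  | |- ?C (fun x => @?P x \/ @?Q x) => apply (adequate_or P Q)
  | |- ?C (fun x => forall i, i < @?n x -> @?P x i) => apply (adequate_ball P n)
  | |- ?C (fun x => forall i, fin_set (@?u x) i -> @?P x i) => apply (adequate_ball_fin_set P u)
  | |- ?C (fun x => forall y, @?P x y) => apply (all_closed P)
  | |- ?C (fun x => ~ @?P x) => change (co_class C P)
  | |- ?C (fun x => fin_set (@?f x) (@?g x)) => apply adequate_decidable, (decidable_fin_set f g)
  | |- ?C (fun x => @?f x = @?g x) => apply adequate_decidable, (decidable_eq f g)
  | |- ?C (fun x => @?f x < @?g x) => apply adequate_decidable, (decidable_lt f g)
  | |- ?C (fun x => @?f x <= @?g x) => apply adequate_decidable, (decidable_le f g)
  | |- ?C (fun x => ?P (@?f x) (@?g x) (@?h x)) =>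
      apply (adequate_comp3 P f g h); [pointclass_leaf | | |]
  | |- ?C (fun x => ?P (@?f x) (@?g x)) => apply (adequate_comp2 P f g); [pointclass_leaf | |]
  | |- ?C (fun x => ?P (@?f x)) => apply (adequate_comp P f); [pointclass_leaf |]
  end.

Ltac pointclass_tac := cbv beta; repeat (pointclass_step; cbv beta).

Definition ex_class (C : nset -> Prop) : nset -> Prop := fun S =>
  exists P : nat -> nset, C (fun z => P (π1 z) (π2 z)) /\ forall x, S x <-> exists y, P x y.

Definition all_class (C : nset -> Prop) : nset -> Prop := fun S =>
  exists P : nat -> nset, C (fun z => P (π1 z) (π2 z)) /\ forall x, S x <-> forall y, P x y.

Lemma ex_class_mono (C C' : nset -> Prop) S :
  (forall P, C P -> C' P) -> ex_class C S -> ex_class C' S.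
Proof. intros CC' [P [HP SP]]. exists P. auto. Qed.

Lemma all_class_mono (C C' : nset -> Prop) S :
  (forall P, C P -> C' P) -> all_class C S -> all_class C' S.
Proof. intros CC' [P [HP SP]]. exists P. auto. Qed.

Lemma co_all_class C S : ex_class (co_class C) S -> co_class (all_class C) S.
Proof.
  intros [P [HP SP]]. exists (fun x y => ~ P x y). split; [exact HP |].
  intro x. rewrite SP. split; eauto. intros none [y Pxy]. exact (none y Pxy).
Qed.

Section ExClass.

Context {C : nset -> Prop} {adequate_C : Adequate C}.

#[export] Instance adequate_co_class : Adequate (co_class C).
Proof.
  unfold co_class. split.
  - intros P HP. now apply adequate_decidable, decidable_not.
  - intros P Q PQ. apply adequate_ext. firstorder.
  - intros P h HP. now apply (adequate_comp (fun x => ~ P x)).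
  - intros P Q HP HQ. apply (adequate_ext (fun x => ~ P x \/ ~ Q x)); [intro; tauto |].
    now apply adequate_or.
  - intros P Q HP HQ. apply (adequate_ext (fun x => ~ P x /\ ~ Q x)); [intro; tauto |].
    now apply adequate_and.
  - intros P n HP Hn. apply (adequate_ext (fun x => exists i, i < n x /\ ~ P x i)).
    + intro x. split; [firstorder |]. intro H. apply NNPP. intro none. apply H.
      intros i lt. apply NNPP. eauto.
    + now apply (adequate_bex (fun x i => ~ P x i)).
  - intros P n HP Hn. apply (adequate_ext (fun x => forall i, i < n x -> ~ P x i)); [firstorder |].
    now apply (adequate_ball (fun x i => ~ P x i)).
Qed.

Lemma co_class_not S : C S -> co_class C (fun x => ~ S x).
Proof. unfold co_class. apply adequate_ext. intro x. tauto. Qed.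

#[export] Instance all_closed_co_class `{ExClosed C} : AllClosed (co_class C).
Proof.
  intros P HP. apply (adequate_ext (C := C) (fun x => exists y, ~ P x y)).
  - intro x. split; [intros [y nPxy] all; exact (nPxy (all y)) | apply not_all_ex_not].
  - now apply (ex_closed (fun x y => ~ P x y)).
Qed.

Lemma ex_class_incl S : C S -> ex_class C S.
Proof.
  intro HS. exists (fun x _ => S x). split; [pointclass_tac |].
  intro x. split; [now exists 0 | now intros [_ Sx]].
Qed.

Lemma ex_class_ex (P : nat -> nset) :
  ex_class C (fun z => P (π1 z) (π2 z)) -> ex_class C (fun x => exists y, P x y).
Proof.
  intros [Q [HQ PQ]]. exists (fun x t => Q ⟨x, π1 t⟩ (π2 t)). split; [pointclass_tac |].
  pose proof (curry_iff _ _ PQ) as PQ'.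
  intro x. split.
  - intros [y Pxy]. apply PQ' in Pxy. destruct Pxy as [w Qw]. exists ⟨y, w⟩. now simp_pair.
  - intros [t Qt]. exists (π1 t). apply PQ'. eauto.
Qed.

Lemma ex_class_ball (P : nat -> nset) n :
  ex_class C (fun z => P (π1 z) (π2 z)) -> recursive n ->
  ex_class C (fun x => forall i, i < n x -> P x i).
Proof.
  intros [Q [HQ PQ]] Hn.
  exists (fun x b => forall i, i < n x -> exists y, y < b /\ Q ⟨x, i⟩ y). split; [pointclass_tac |].
  pose proof (curry_iff _ _ PQ) as PQ'.
  intro x. split.
  - intro H. apply bounded_collection; [apply bounded_lt |]. intros i lt. now apply PQ', H.
  - intros [b Hb] i lt. apply PQ'. destruct (Hb i lt) as [y [_ Qy]]. eauto.
Qed.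

Lemma ex_class_bex (P : nat -> nset) n :
  ex_class C (fun z => P (π1 z) (π2 z)) -> recursive n ->
  ex_class C (fun x => exists i, i < n x /\ P x i).
Proof.
  intros [Q [HQ PQ]] Hn.
  exists (fun x y => exists i, i < n x /\ Q ⟨x, i⟩ y). split; [pointclass_tac |].
  pose proof (curry_iff _ _ PQ) as PQ'.
  intro x. split.
  - intros [i [lt Pi]]. apply PQ' in Pi. destruct Pi as [y Qy]. eauto.
  - intros [y [i [lt Qy]]]. exists i. split; [exact lt |]. apply PQ'. eauto.
Qed.

#[export] Instance adequate_ex_class : Adequate (ex_class C).
Proof.
  split; auto using ex_class_ball, ex_class_bex.
  - intros P HP. now apply ex_class_incl, adequate_decidable.
  - intros P Q PQ [R [HR PR]]. exists R. split; [exact HR |]. intro x. now rewrite <- PQ.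
  - intros P h [R [HR PR]] Hh. exists (fun x => R (h x)). split; [pointclass_tac | auto].
  - intros P Q [R [HR PR]] [T [HT QT]]. exists (fun x y => R x (π1 y) /\ T x (π2 y)).
    split; [pointclass_tac |]. intro x. rewrite PR, QT. split.
    + intros [[y Ry] [w Tw]]. exists ⟨y, w⟩. now simp_pair.
    + intros [y [Ry Ty]]. eauto.
  - intros P Q [R [HR PR]] [T [HT QT]]. exists (fun x y => R x y \/ T x y).
    split; [pointclass_tac |]. intro x. rewrite PR, QT.
    split; [intros [[y Ry]|[y Ty]] | intros [y [Ry|Ty]]]; eauto.
Qed.

#[export] Instance ex_closed_ex_class : ExClosed (ex_class C).
Proof. intro P. apply ex_class_ex. Qed.

Lemma ex_class_idem S : ex_class (ex_class C) S -> ex_class C S.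
Proof.
  intros [P [HP SP]]. apply (adequate_ext (fun x => exists y, P x y)).
  - intro x. symmetry. apply SP.
  - now apply ex_closed.
Qed.

End ExClass.

Section AllClass.

Context {C : nset -> Prop} {adequate_C : Adequate C}.

Lemma all_class_iff_co_ex_class S : all_class C S <-> co_class (ex_class (co_class C)) S.
Proof.
  split.
  - intros [P [HP SP]]. exists (fun x y => ~ P x y). split; [now apply co_class_not |].
    intro x. rewrite SP. split; [apply not_all_ex_not | intros [y nPy] H; exact (nPy (H y))].
  - intros [P [HP SP]]. exists (fun x y => ~ P x y). split; [exact HP |].
    intro x. specialize (SP x). split.
    + intros Sx y Pxy. apply SP; eauto.
    + intro none. apply NNPP. intro nSx. apply SP in nSx.
      destruct nSx as [y Pxy]. exact (none y Pxy).
Qed.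

#[export] Instance adequate_all_class : Adequate (all_class C).
Proof.
  pose proof all_class_iff_co_ex_class as E.
  pose proof (adequate_co_class (C := ex_class (co_class C))) as co.
  destruct co as [dec ext comp conj disj ball bex].
  split; intros; rewrite E in *; eauto.
Qed.

Lemma all_class_incl S : C S -> all_class C S.
Proof.
  intro HS. exists (fun x _ => S x). split; [pointclass_tac |].
  intro x. split; [auto |]. intro H. exact (H 0).
Qed.

#[export] Instance all_closed_all_class : AllClosed (all_class C).
Proof.
  intros P [Q [HQ PQ]]. exists (fun x t => Q ⟨x, π1 t⟩ (π2 t)). split; [pointclass_tac |].
  pose proof (curry_iff _ _ PQ) as PQ'.
  intro x. split.
  - intros H t. now apply PQ'.
  - intros H y. apply PQ'. intro w. specialize (H ⟨y, w⟩). now simp_pair.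
Qed.

End AllClass.

(** * Least fixed points of enumeration operators *)

Inductive derived (G : nat -> nset) : nset :=
| derived_intro z u : u ⊆ derived G -> G z u -> derived G z.

(* The members ⟨s, z⟩ of [w] carry a rank [s], which makes the derivation well founded. *)
Definition derivation (G : nat -> nset) (w : nat) : Prop :=
  forall t, fin_set w t ->
    exists u, G (π2 t) u /\ forall i, fin_set u i -> exists s, s < π1 t /\ fin_set w ⟨s, i⟩.

Lemma derivation_exists G z :
  derived G z -> exists w, derivation G w /\ exists s, fin_set w ⟨s, z⟩.
Proof.
  induction 1 as [z u _ IH Gzu].
  destruct (bounded_collection (fin_set u) (fun i w =>
    derivation G w /\ exists s, fin_set w ⟨s, i⟩) (bounded_fin_set u) IH) as [n Hn].
  destruct (fin_set_bounded (fun t =>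
    t = ⟨n, z⟩ \/ exists w, w < n /\ derivation G w /\ fin_set w t)) as [v Hv].
  { apply bounded_or; [apply bounded_eq |]. apply bounded_incl with (fun t => t < n).
    - intros t [w [lt_wn [_ wt]]]. apply fin_set_lt in wt. lia.
    - apply bounded_lt. }
  exists v. split; [| exists n; apply Hv; auto].
  intros t vt. apply Hv in vt. destruct vt as [->|[w [lt_wn [der_w wt]]]].
  - exists u. simp_pair. split; [exact Gzu |]. intros i ui.
    destruct (Hn i ui) as [w [lt_wn [der_w [s wsi]]]].
    exists s. split; [| apply Hv; eauto].
    pose proof (pair_le s i). apply fin_set_lt in wsi. lia.
  - destruct (der_w t wt) as [u' [Gu' premises]]. exists u'. split; [exact Gu' |].
    intros i ui. destruct (premises i ui) as [s [lt_s wsi]].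
    exists s. split; [exact lt_s |]. apply Hv. eauto.
Qed.

Lemma derivation_sound G w : derivation G w -> forall s z, fin_set w ⟨s, z⟩ -> derived G z.
Proof.
  intros der_w s. induction s as [s IH] using lt_wf_ind. intros z wsz.
  destruct (der_w _ wsz) as [u [Gzu premises]]. simp_pair.
  apply derived_intro with u; [| exact Gzu].
  intros i ui. destruct (premises i ui) as [s' [lt_s' ws'i]]. eauto.
Qed.

Lemma derived_closed {C} `{Adequate C} `{ExClosed C} G :
  C (fun z => G (π1 z) (π2 z)) -> C (derived G).
Proof.
  intro HG. apply (adequate_ext (fun z => exists w, derivation G w /\ exists s, fin_set w ⟨s, z⟩)).
  - intro z. split; [| apply derivation_exists].
    intros [w [der_w [s wsz]]]. exact (derivation_sound G w der_w s z wsz).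
  - unfold derivation. pointclass_tac.
Qed.

(** * Semirecursive sets and the universal machine *)

Definition sigma1 : nset -> Prop := ex_class decidable.

Lemma sigma1_incl {C} `{Adequate C} `{ExClosed C} S : sigma1 S -> C S.
Proof.
  intros [P [HP SP]]. apply (adequate_ext (fun x => exists y, P x y)).
  - intro x. symmetry. apply SP.
  - now apply ex_closed, adequate_decidable.
Qed.

Lemma co_sigma1_incl {C} `{Adequate C} `{ExClosed C} S : co_class sigma1 S -> co_class C S.
Proof. unfold co_class. apply sigma1_incl. Qed.

#[export] Hint Extern 1 => apply sigma1_incl; assumption : pointclass.
#[export] Hint Extern 1 (co_class _ _) => apply co_sigma1_incl; assumption : pointclass.

Fixpoint encode (c : code) : nat :=
  match c with
  | Zero => ⟨0, 0⟩
  | Succ => ⟨1, 0⟩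
  | Left => ⟨2, 0⟩
  | Right => ⟨3, 0⟩
  | Pair f g => ⟨4, ⟨encode f, encode g⟩⟩
  | Comp f g => ⟨5, ⟨encode f, encode g⟩⟩
  | Prec f g => ⟨6, ⟨encode f, encode g⟩⟩
  | Mu f => ⟨7, encode f⟩
  end.

(** [justified w t r x y]: that the code [⟨t, r⟩] maps [x] to [y] follows in one step from the
    computations [⟨c, ⟨x', y'⟩⟩] in [w]. *)
Definition justified (w t r x y : nat) : Prop :=
  (t = 0 /\ y = 0) \/
  (t = 1 /\ y = S x) \/
  (t = 2 /\ y = π1 x) \/
  (t = 3 /\ y = π2 x) \/
  (t = 4 /\ fin_set w ⟨π1 r, ⟨x, π1 y⟩⟩ /\ fin_set w ⟨π2 r, ⟨x, π2 y⟩⟩) \/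
  (t = 5 /\ exists z, fin_set w ⟨π2 r, ⟨x, z⟩⟩ /\ fin_set w ⟨π1 r, ⟨z, y⟩⟩) \/
  (t = 6 /\ π2 x = 0 /\ fin_set w ⟨π1 r, ⟨π1 x, y⟩⟩) \/
  (t = 6 /\ exists n s, π2 x = S n /\ fin_set w ⟨⟨6, r⟩, ⟨⟨π1 x, n⟩, s⟩⟩ /\
                        fin_set w ⟨π2 r, ⟨⟨π1 x, ⟨n, s⟩⟩, y⟩⟩) \/
  (t = 7 /\ fin_set w ⟨r, ⟨⟨x, y⟩, 0⟩⟩ /\
            forall m, m < y -> exists k, fin_set w ⟨r, ⟨⟨x, m⟩, S k⟩⟩).

Definition eval_rule (z w : nat) : Prop :=
  justified w (π1 (π1 z)) (π2 (π1 z)) (π1 (π2 z)) (π2 (π2 z)).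

Definition ueval (c x y : nat) : Prop := derived eval_rule ⟨c, ⟨x, y⟩⟩.

Definition univ (i x : nat) : Prop := exists y, ueval i x y.

Lemma sigma1_ueval : sigma1 (fun z => ueval (π1 z) (π1 (π2 z)) (π2 (π2 z))).
Proof.
  unfold ueval. assert (sigma1 (derived eval_rule)); [| pointclass_tac].
  apply derived_closed. unfold eval_rule, justified. pointclass_tac.
Qed.

Lemma sigma1_univ : sigma1 (fun z => univ (π1 z) (π2 z)).
Proof. pose proof sigma1_ueval. unfold univ. pointclass_tac. Qed.

(* A bound [n] on the premises suffices, since [w] may contain all derived numbers below [n]. *)
Lemma ueval_intro n c x y :
  (forall w, (forall i, i < n -> derived eval_rule i -> fin_set w i) ->
     justified w (π1 c) (π2 c) x y) ->
  ueval c x y.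
Proof.
  intro H. destruct (fin_set_bounded (fun i => i < n /\ derived eval_rule i)) as [w Hw].
  { exists n. tauto. }
  apply derived_intro with w.
  - intros i wi. now apply Hw.
  - unfold eval_rule. simp_pair. apply H. intros i lt der. now apply Hw.
Qed.

Lemma ueval_elim c x y :
  ueval c x y -> exists w, w ⊆ derived eval_rule /\ justified w (π1 c) (π2 c) x y.
Proof.
  intro H. inversion H as [z w der rule]. exists w. unfold eval_rule in rule. now simp_pair.
Qed.

Lemma eval_ueval c : forall x y, eval c x y -> ueval (encode c) x y.
Proof.
  induction c as [| | | |f IHf g IHg|f IHf g IHg|f IHf g IHg|f IHf]; intros x y E; cbn [encode].
  - apply (ueval_intro 0). intros w _. simp_pair. left. auto.
  - apply (ueval_intro 0). intros w _. simp_pair. right; left. auto.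
  - apply (ueval_intro 0). intros w _. simp_pair. do 2 right; left. auto.
  - apply (ueval_intro 0). intros w _. simp_pair. do 3 right; left. auto.
  - destruct E as [a [b [Ea [Eb ->]]]]. apply IHf in Ea. apply IHg in Eb.
    apply (ueval_intro (S (⟨encode f, ⟨x, a⟩⟩ + ⟨encode g, ⟨x, b⟩⟩))). intros w Hw.
    simp_pair. do 4 right; left. simp_pair. repeat split; apply Hw; auto; lia.
  - destruct E as [z [Ez Ey]]. apply IHg in Ez. apply IHf in Ey.
    apply (ueval_intro (S (⟨encode g, ⟨x, z⟩⟩ + ⟨encode f, ⟨z, y⟩⟩))). intros w Hw.
    simp_pair. do 5 right; left. simp_pair. split; [reflexivity |].
    exists z. split; apply Hw; auto; lia.
  - cbn [eval] in E. rewrite <- (pair_eta x). destruct (Cantor.of_nat x) as [a n]. clear x.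
    cbn [fst snd]. revert y E. induction n as [|n IH]; cbn [nat_rect]; intros y E.
    + apply IHf in E. apply (ueval_intro (S ⟨encode f, ⟨a, y⟩⟩)). intros w Hw.
      simp_pair. do 6 right; left. simp_pair. repeat split. apply Hw; auto; lia.
    + destruct E as [s [Es Ey]]. apply IH in Es. apply IHg in Ey.
      apply (ueval_intro (S (⟨⟨6, ⟨encode f, encode g⟩⟩, ⟨⟨a, n⟩, s⟩⟩ +
                             ⟨encode g, ⟨⟨a, ⟨n, s⟩⟩, y⟩⟩))). intros w Hw.
      simp_pair. do 7 right; left. split; [reflexivity |]. exists n, s. simp_pair.
      repeat split; apply Hw; auto; lia.
  - destruct E as [E0 E]. apply IHf in E0.
    destruct (bounded_collection (fun m => m < y) (fun m n =>
      exists k, n = ⟨encode f, ⟨⟨x, m⟩, S k⟩⟩ /\ ueval (encode f) ⟨x, m⟩ (S k))) as [n Hn].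
    { apply bounded_lt. }
    { intros m lt. destruct (E m lt) as [k Ek]. eauto. }
    apply (ueval_intro (S (⟨encode f, ⟨⟨x, y⟩, 0⟩⟩ + n))). intros w Hw.
    simp_pair. do 8 right. repeat split; [apply Hw; auto; lia |].
    intros m lt. destruct (Hn m lt) as [i [lt_in [k [-> Ek]]]].
    exists k. apply Hw; [lia | exact Ek].
Qed.

Ltac invert_ueval U :=
  apply ueval_elim in U;
  let w := fresh "w" in let der := fresh "der" in let t_eq := fresh "t_eq" in
  destruct U as [w [der U]]; simp_pair;
  destruct U as [U|[U|[U|[U|[U|[U|[U|[U|U]]]]]]]];
  destruct U as [t_eq U]; try discriminate t_eq; clear t_eq; simp_pair.

Lemma ueval_eval c : forall x y, ueval (encode c) x y -> eval c x y.
Proof.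
  induction c as [| | | |f IHf g IHg|f IHf g IHg|f IHf g IHg|f IHf];
    intros x y U; cbn [encode] in *.
  - now invert_ueval U.
  - now invert_ueval U.
  - now invert_ueval U.
  - now invert_ueval U.
  - invert_ueval U. destruct U as [Ua Ub]. exists (π1 y), (π2 y). rewrite pair_eta.
    repeat split; [apply IHf | apply IHg]; now apply der.
  - invert_ueval U. destruct U as [z [Uz Uy]].
    exists z. split; [apply IHg | apply IHf]; now apply der.
  - cbn [eval]. rewrite <- (pair_eta x) in U. destruct (Cantor.of_nat x) as [a n]. clear x.
    cbn [fst snd] in U. revert y U. induction n as [|n IH]; cbn [nat_rect]; intros y U.
    + invert_ueval U; [apply IHf; now apply der |]. destruct U as [m [s [n_eq _]]]. discriminate.
    + invert_ueval U; [destruct U as [n_eq _]; discriminate |].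
      destruct U as [m [s [n_eq [Us Uy]]]]. injection n_eq as <-.
      exists s. split; [apply IH | apply IHg]; now apply der.
  - invert_ueval U. destruct U as [U0 U]. split; [apply IHf; now apply der |].
    intros m lt. destruct (U m lt) as [k Uk]. exists k. apply IHf. now apply der.
Qed.

Lemma eval_functional c : forall x y y', eval c x y -> eval c x y' -> y = y'.
Proof.
  induction c as [| | | |f IHf g IHg|f IHf g IHg|f IHf g IHg|f IHf]; cbn [eval]; intros x y y' E E';
    try congruence.
  - destruct E as [a [b [Ea [Eb ->]]]], E' as [a' [b' [Ea' [Eb' ->]]]].
    now rewrite (IHf _ _ _ Ea Ea'), (IHg _ _ _ Eb Eb').
  - destruct E as [z [Ez Ey]], E' as [z' [Ez' Ey']]. rewrite (IHg _ _ _ Ez Ez') in Ey. eauto.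
  - destruct (Cantor.of_nat x) as [a n]. revert y y' E E'.
    induction n as [|n IH]; cbn [nat_rect]; intros y y' E E'; [eauto |].
    destruct E as [s [Es Ey]], E' as [s' [Es' Ey']]. rewrite (IH _ _ Es Es') in Ey. eauto.
  - destruct E as [E0 E], E' as [E0' E'].
    destruct (Nat.lt_trichotomy y y') as [lt|[eq|lt]]; [| exact eq |].
    + destruct (E' y lt) as [k Ek]. discriminate (IHf _ _ _ E0 Ek).
    + destruct (E y' lt) as [k Ek]. discriminate (IHf _ _ _ E0' Ek).
Qed.

Lemma eval_iff_ueval c x y : eval c x y <-> ueval (encode c) x y.
Proof. split; [apply eval_ueval | apply ueval_eval]. Qed.

Lemma sigma1_iff_ce W : sigma1 W <-> ce W.
Proof.
  split.
  - intros [P [[f [[c Hc] Pf]] WP]]. exists (Mu c).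
    pose proof (curry_iff _ _ Pf) as Pf'.
    intro x. rewrite WP. cbn [eval]. split.
    + intro H. apply least_witness in H. destruct H as [y [Py least]]. exists y. split.
      * apply Pf' in Py. rewrite <- Py. apply Hc.
      * intros m lt. exists (pred (f ⟨x, m⟩)). rewrite Nat.succ_pred; [apply Hc |].
        rewrite <- Pf'. auto.
    + intros [y [E0 _]]. exists y. apply Pf'. apply (eval_functional c ⟨x, y⟩); auto.
  - intros [c Hc]. apply (adequate_ext (fun x => exists y, ueval (encode c) x y)).
    + intro x. rewrite Hc. split; intros [y E]; exists y; now apply eval_iff_ueval.
    + pose proof sigma1_ueval. pointclass_tac.
Qed.

Lemma sigma1_enumeration W : sigma1 W -> exists i, forall x, W x <-> univ i x.
Proof.
  rewrite sigma1_iff_ce. intros [c Hc]. exists (encode c). intro x. rewrite Hc. unfold univ.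
  split; intros [y E]; exists y; now apply eval_iff_ueval.
Qed.

(** * Enumeration reducibility *)

Lemma e_le_iff_sigma1 S B :
  S ≤ₑ B <->
  exists G, sigma1 (fun z => G (π1 z) (π2 z)) /\ forall x, S x <-> exists u, u ⊆ B /\ G x u.
Proof.
  split.
  - intros [G [HG SG]]. exists (fun x u => G ⟨x, u⟩). split; [| exact SG].
    apply (adequate_ext G); [intro z; now rewrite pair_eta | now apply sigma1_iff_ce].
  - intros [G [HG SG]]. exists (fun z => G (π1 z) (π2 z)). split; [now apply sigma1_iff_ce |].
    intro x. rewrite SG. now split; intros [u H]; exists u; simp_pair.
Qed.

Lemma e_le_refl B : B ≤ₑ B.
Proof.
  apply e_le_iff_sigma1. exists (fun x u => fin_set u x). split; [pointclass_tac |].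
  intro x. split.
  - intro Bx. destruct (fin_set_bounded (fun i => i = x)) as [u Hu]; [apply bounded_eq |].
    exists u. split; [| now apply Hu]. intros i ui. apply Hu in ui. now subst.
  - intros [u [uB ux]]. now apply uB.
Qed.

Definition e_ideal (B : nset) : nset -> Prop := fun S => S ≤ₑ B.

Lemma e_ideal_ball B (P : nat -> nset) n :
  e_ideal B (fun z => P (π1 z) (π2 z)) -> recursive n ->
  e_ideal B (fun x => forall i, i < n x -> P x i).
Proof.
  unfold e_ideal. rewrite !e_le_iff_sigma1. intros [G [HG PG]] Hn.
  pose proof (curry_iff _ _ PG) as PG'.
  exists (fun x w => forall i, i < n x -> exists u, u ⊆ fin_set w /\ G ⟨x, i⟩ u).
  split; [pointclass_tac |]. intro x. split.
  - intro H.
    destruct (bounded_collection (fun i => i < n x) (fun i u => u ⊆ B /\ G ⟨x, i⟩ u)) as [b Hb].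
    { apply bounded_lt. }
    { intros i lt. now apply PG', H. }
    destruct (fin_set_bounded (fun i => i < b /\ B i)) as [w Hw]; [exists b; tauto |].
    exists w. split; [intros i wi; now apply Hw |].
    intros i lt. destruct (Hb i lt) as [u [lt_ub [uB Gu]]]. exists u. split; [| exact Gu].
    intros j uj. apply Hw. split; [apply fin_set_lt in uj; lia | auto].
  - intros [w [wB H]] i lt. apply PG'. destruct (H i lt) as [u [uw Gu]]. eauto.
Qed.

#[export] Instance ex_closed_e_ideal B : ExClosed (e_ideal B).
Proof.
  intro P. unfold e_ideal. rewrite !e_le_iff_sigma1. intros [G [HG PG]].
  exists (fun x u => exists y, G ⟨x, y⟩ u). split; [pointclass_tac |].
  pose proof (curry_iff _ _ PG) as PG'.
  intro x. split.
  - intros [y Pxy]. apply PG' in Pxy. destruct Pxy as [u [uB Gu]]. eauto.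
  - intros [u [uB [y Gu]]]. exists y. apply PG'. eauto.
Qed.

Lemma e_ideal_and B (P Q : nset) : e_ideal B P -> e_ideal B Q -> e_ideal B (fun x => P x /\ Q x).
Proof.
  unfold e_ideal. rewrite !e_le_iff_sigma1. intros [G [HG PG]] [G' [HG' QG']].
  exists (fun x w => (exists u, u ⊆ fin_set w /\ G x u) /\ exists v, v ⊆ fin_set w /\ G' x v).
  split; [pointclass_tac |]. intro x. rewrite PG, QG'. split.
  - intros [[u [uB Gu]] [v [vB G'v]]].
    destruct (fin_set_bounded (fun i => fin_set u i \/ fin_set v i)) as [w Hw].
    { apply bounded_or; apply bounded_fin_set. }
    exists w. split; [intros i wi; apply Hw in wi; destruct wi; auto |].
    split; [exists u | exists v]; split; auto; intros; apply Hw; auto.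
  - intros [w [wB [[u [uw Gu]] [v [vw G'v]]]]]. split; [exists u | exists v]; auto.
Qed.

#[export] Instance adequate_e_ideal B : Adequate (e_ideal B).
Proof.
  assert (ext : forall P Q : nset, (forall x, P x <-> Q x) -> e_ideal B P -> e_ideal B Q).
  { intros P Q PQ [G [HG PG]]. exists G. split; [exact HG |]. intro x. now rewrite <- PQ. }
  assert (dec : forall P, decidable P -> e_ideal B P).
  { intros P HP. apply e_le_iff_sigma1. exists (fun x _ => P x). split.
    - apply adequate_decidable. pointclass_tac.
    - intro x. split; [| now intros [u [_ Px]]].
      intro Px. exists 0. split; [apply fin_set_0 | exact Px]. }
  split; auto using e_ideal_ball, e_ideal_and.
  - unfold e_ideal. intros P h. rewrite !e_le_iff_sigma1. intros [G [HG PG]] Hh.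
    exists (fun x u => G (h x) u). split; [pointclass_tac | auto].
  - unfold e_ideal. intros P Q. rewrite !e_le_iff_sigma1. intros [G [HG PG]] [G' [HG' QG']].
    exists (fun x u => G x u \/ G' x u). split; [pointclass_tac |].
    intro x. rewrite PG, QG'.
    split; [intros [[u [uB Gu]]|[u [uB G'u]]] | intros [u [uB [Gu|G'u]]]]; eauto.
  - intros P n HP Hn. apply ex_closed, e_ideal_and; [| exact HP].
    apply dec. pointclass_tac.
Qed.

#[export] Hint Extern 1 (e_ideal ?B ?B) => exact (e_le_refl B) : pointclass.

Lemma e_le_closed {C} `{Adequate C} `{ExClosed C} S B : S ≤ₑ B -> C B -> C S.
Proof.
  rewrite e_le_iff_sigma1. intros [G [HG SG]] HB.
  apply (adequate_ext (fun x => exists u, u ⊆ B /\ G x u)).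
  - intro x. symmetry. apply SG.
  - pointclass_tac.
Qed.

Lemma e_le_trans S B B' : S ≤ₑ B -> B ≤ₑ B' -> S ≤ₑ B'.
Proof. exact (e_le_closed S B). Qed.

Lemma e_lt_of_not_e_le D Z B : D ≤ₑ Z -> D ≤ₑ B -> ~ Z ≤ₑ B -> D <ₑ Z.
Proof. intros DZ DB ZB. split; [exact DZ |]. intro ZD. apply ZB. now apply e_le_trans with D. Qed.

Lemma e_le_empty B : (fun _ => False) ≤ₑ B.
Proof.
  apply (adequate_ext (C := e_ideal B) (fun _ => 0 = 1)); [intro; lia |]. pointclass_tac.
Qed.

Definition e_op (j : nat) (B : nset) : nset := fun x => exists u, u ⊆ B /\ univ j ⟨x, u⟩.

Lemma e_le_iff_e_op S B : S ≤ₑ B <-> exists j, forall x, S x <-> e_op j B x.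
Proof.
  rewrite e_le_iff_sigma1. split.
  - intros [G [HG SG]]. destruct (sigma1_enumeration _ HG) as [j Hj]. exists j. intro x.
    rewrite SG. unfold e_op.
    split; intros [u [uB Gu]]; exists u; specialize (Hj ⟨x, u⟩); simp_pair; tauto.
  - intros [j Sj]. exists (fun x u => univ j ⟨x, u⟩). split; [| exact Sj].
    pose proof sigma1_univ. pointclass_tac.
Qed.

Lemma e_ideal_e_op B : e_ideal B (fun z => e_op (π1 z) B (π2 z)).
Proof. pose proof sigma1_univ. unfold e_op. pointclass_tac. Qed.

Definition e_join (X Y : nset) : nset := fun z => (π1 z = 0 /\ X (π2 z)) \/ (π1 z = 1 /\ Y (π2 z)).

Lemma e_join_l X Y : X ≤ₑ e_join X Y.
Proof.
  apply (adequate_ext (C := e_ideal (e_join X Y)) (fun x => e_join X Y ⟨0, x⟩)).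
  - intro x. unfold e_join. simp_pair. intuition discriminate.
  - pointclass_tac.
Qed.

Lemma e_join_r X Y : Y ≤ₑ e_join X Y.
Proof.
  apply (adequate_ext (C := e_ideal (e_join X Y)) (fun x => e_join X Y ⟨1, x⟩)).
  - intro x. unfold e_join. simp_pair. intuition discriminate.
  - pointclass_tac.
Qed.

Lemma e_join_lub X Y B : X ≤ₑ B -> Y ≤ₑ B -> e_join X Y ≤ₑ B.
Proof. intros XB YB. change (e_ideal B (e_join X Y)). unfold e_join. pointclass_tac. Qed.

(** * Levels of the arithmetical hierarchy *)

Definition sigma2 : nset -> Prop := ex_class (co_class sigma1).

Lemma decidable_computable R : decidable R -> computable R.
Proof.
  intros [f [Hf Rf]].
  destruct (recursive_sub _ _ (recursive_const 1) Hf) as [c Hc]. exists c.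
  intro x. specialize (Hc x). rewrite Rf. destruct (f x); [left | right]; auto.
Qed.

Lemma computable_co_sigma1 R : computable R -> co_class sigma1 R.
Proof.
  intros [c Hc]. apply (adequate_ext (C := sigma1) (fun x => ueval (encode c) x 0)).
  - intro x. rewrite <- eval_iff_ueval. destruct (Hc x) as [[Rx E1]|[nRx E0]]; [| tauto].
    split; [| contradiction]. intro E0. discriminate (eval_functional c x 1 0 E1 E0).
  - pose proof sigma1_ueval. pointclass_tac.
Qed.

Lemma sigma2_iff_Sigma02 A : sigma2 A <-> Sigma02 A.
Proof.
  split.
  - intros [P [[Q [HQ PQ]] AP]].
    exists (fun t => ~ Q ⟨π1 t, π1 (π2 t)⟩ (π2 (π2 t))). split.
    + apply decidable_computable, decidable_not. pointclass_tac.
    + intro x. rewrite AP. split; intros [a Ha]; exists a; specialize (PQ ⟨x, a⟩); simp_pair.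
      * intros b Qb. simp_pair. apply PQ; eauto.
      * apply NNPP. intro nPa. apply PQ in nPa. destruct nPa as [b Qb].
        apply (Ha b). now simp_pair.
  - intros [R [HR AR]]. exists (fun x a => forall b, R ⟨x, ⟨a, b⟩⟩). split; [| exact AR].
    pose proof (computable_co_sigma1 R HR). pointclass_tac.
Qed.

Lemma sigma2_co_all_class {C} `{Adequate C} `{ExClosed C} S :
  sigma2 S -> co_class (all_class C) S.
Proof.
  intro HS. apply co_all_class. revert HS. apply ex_class_mono. intro P. apply co_sigma1_incl.
Qed.

Lemma all_class_equal_sections {C} `{Adequate C} `{ExClosed C} (P Q : nat -> nset) :
  sigma2 (fun z => P (π1 z) (π2 z)) -> all_class C (fun z => P (π1 z) (π2 z)) ->
  sigma2 (fun z => Q (π1 z) (π2 z)) -> all_class C (fun z => Q (π1 z) (π2 z)) ->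
  all_class C (fun z => forall x, P (π1 z) x <-> Q (π2 z) x).
Proof.
  intros sigma2_P HP sigma2_Q HQ. apply all_closed.
  apply adequate_iff; [| apply sigma2_co_all_class | | apply sigma2_co_all_class]; pointclass_tac.
Qed.

Definition pi3 : nset -> Prop := all_class sigma2.

Definition sigma4 : nset -> Prop := ex_class pi3.

(** Relative to [B], the hierarchy starts from the sets enumeration reducible to [B], that is, it
    uses [B] positively only. *)
Definition pi2_in (B : nset) : nset -> Prop := all_class (e_ideal B).

Definition sigma3_in (B : nset) : nset -> Prop := ex_class (pi2_in B).

Lemma pi3_co_sigma3_in B S : pi3 S -> co_class (sigma3_in B) S.
Proof.
  intros [P [HP SP]]. exists (fun x l => ~ P x l). split.
  - now apply sigma2_co_all_class.
  - intro x. rewrite SP. split; [apply not_all_ex_not | intros [l nPl] H; exact (nPl (H l))].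
Qed.

Lemma sigma3_in_mono B B' S : B ≤ₑ B' -> sigma3_in B S -> sigma3_in B' S.
Proof.
  intro BB'. apply ex_class_mono. intro P. apply all_class_mono. intros Q QB.
  now apply e_le_trans with B.
Qed.

Lemma sigma4_sigma3_in B S :
  (forall P, pi3 P -> sigma3_in B P) -> sigma4 S -> sigma3_in B S.
Proof. intros incl HS. apply ex_class_idem. revert HS. now apply ex_class_mono. Qed.

Lemma sigma4_enumeration S :
  sigma4 S ->
  exists i, forall e, S e <-> exists k, forall l, exists b, ~ univ i ⟨⟨⟨e, k⟩, l⟩, b⟩.
Proof.
  intros [P [[Q [[R [HR QR]] PQ]] SP]].
  destruct (sigma1_enumeration _ HR) as [i Hi]. exists i.
  pose proof (curry_iff _ _ PQ) as PQ'. pose proof (curry_iff _ _ QR) as QR'.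
  assert (Hi' : forall z b, R z b <-> ~ univ i ⟨z, b⟩).
  { intros z b. rewrite <- Hi. simp_pair. tauto. }
  intro e. rewrite SP. setoid_rewrite PQ'. setoid_rewrite QR'. now setoid_rewrite Hi'.
Qed.

Lemma sigma4_not_closed_under_complement : exists S, sigma4 S /\ ~ co_class sigma4 S.
Proof.
  exists (fun e => exists k, forall l, exists b, ~ univ e ⟨⟨⟨e, k⟩, l⟩, b⟩). split.
  - assert (co_univ : co_class sigma2 (fun z => univ (π1 z) (π2 z))).
    { apply ex_class_incl, co_class_not, sigma1_univ. }
    exists (fun e k => forall l, exists b, ~ univ e ⟨⟨⟨e, k⟩, l⟩, b⟩). split; [| reflexivity].
    exists (fun z l => exists b, ~ univ (π1 z) ⟨⟨⟨π1 z, π2 z⟩, l⟩, b⟩). split; [| reflexivity].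
    pointclass_tac.
  - intro co. apply sigma4_enumeration in co. destruct co as [i Hi]. specialize (Hi i). tauto.
Qed.

(** * A uniform family of intermediate sets *)

Section Coding.

Variables A D : nset.
Variable X : nat -> nat -> nat -> Prop.

(* The Π⁰₁ matrices of Σ⁰₂ definitions of [A] and of [guess_axiom] below. *)
Variables A_wit ax_wit : nat -> nat -> Prop.

(** A number [q] = ⟨i, p⟩ is a guess at a set: column 0 is [D], the columns 1, ..., i are given
    by the finite set [p], and all other columns are full. *)
Definition guess (q : nat) : nset := fun v =>
  (π1 v = 0 /\ D (π2 v)) \/ π1 q < π1 v \/ exists k, π1 v = S k /\ fin_set (π2 q) ⟨k, π2 v⟩.

Definition guess_axiom (q t : nat) : Prop := univ (π1 q) t /\ π2 t ⊆ guess q.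

(** [agree q ⟨⟨y, u⟩, a⟩]: [a] does not witness that [A] and the set [e_op i (guess q)] differ at
    [y].  Phrased with refuted witnesses, this is a positive condition on [A]. *)
Definition agree (q m : nat) : Prop :=
  (~ ax_wit ⟨q, π1 m⟩ (π2 m) \/ A (π1 (π1 m))) /\
  (~ A_wit (π1 (π1 m)) (π2 m) \/ exists u, guess_axiom q ⟨π1 (π1 m), u⟩).

Definition initially (e k y : nat) : Prop := forall b, b < S y -> X e k b.

Definition dump_condition (earlier : nat -> nset) (e c x : nat) : Prop :=
  exists i p, i <= c /\
    (forall z, fin_set p z -> π1 z < c /\ (earlier (π1 z) (π2 z) \/ initially e (π1 z) (π2 z))) /\
    forall m, m < x -> agree ⟨i, p⟩ m.

Definition dump_rule (t w : nat) : Prop :=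
  dump_condition (fun k y => fin_set w ⟨π1 t, ⟨k, y⟩⟩) (π1 t) (π1 (π2 t)) (π2 (π2 t)).

(** [dump e c x] means that [x] is at most [s c], the largest first disagreement with [A] of a guess
    ⟨i, p⟩ such that [i <= c] and [p] is consistent with the columns before [c] of [coded e]; these
    in turn depend on [s k] for [k < c]. *)
Definition dump (e c x : nat) : Prop := derived dump_rule ⟨e, ⟨c, x⟩⟩.

Definition coded (e : nat) : nset := fun t =>
  (π1 t = 0 /\ D (π2 t)) \/
  exists k, π1 t = S k /\
    (dump e k (S (π2 t)) \/ (dump e k (π2 t) /\ A k) \/ (initially e k (π2 t) /\ A (π2 t))).

Lemma e_ideal_guess_axiom : e_ideal D (fun z => guess_axiom (π1 z) (π2 z)).
Proof. pose proof sigma1_univ. unfold guess_axiom, guess. pointclass_tac. Qed.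

Lemma e_ideal_dump :
  D ≤ₑ A -> e_ideal A (fun z => X (π1 z) (π1 (π2 z)) (π2 (π2 z))) ->
  co_class sigma1 (fun z => A_wit (π1 z) (π2 z)) ->
  co_class sigma1 (fun z => ax_wit (π1 z) (π2 z)) ->
  e_ideal A (fun z => dump (π1 z) (π1 (π2 z)) (π2 (π2 z))).
Proof.
  intros DA XA co_A_wit co_ax_wit. pose proof (e_le_trans _ _ _ e_ideal_guess_axiom DA).
  assert (e_ideal A (fun z => agree (π1 z) (π2 z))) by (unfold agree; pointclass_tac).
  assert (e_ideal A (derived dump_rule)).
  { apply derived_closed. unfold dump_rule, dump_condition, initially. pointclass_tac. }
  unfold dump. pointclass_tac.
Qed.

Lemma e_ideal_coded :
  D ≤ₑ A -> e_ideal A (fun z => X (π1 z) (π1 (π2 z)) (π2 (π2 z))) ->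
  e_ideal A (fun z => dump (π1 z) (π1 (π2 z)) (π2 (π2 z))) ->
  e_ideal A (fun z => coded (π1 z) (π2 z)).
Proof. intros DA XA dumpA. unfold coded, initially. pointclass_tac. Qed.

Lemma dump_iff e c x : dump e c x <-> dump_condition (dump e) e c x.
Proof.
  split.
  - intro H. inversion H as [t w der [i [p [le_ic [Hp Hx]]]]]. simp_pair.
    exists i, p. split; [exact le_ic |]. split; [| exact Hx].
    intros z pz. destruct (Hp z pz) as [lt [wz|init]]; split; auto. left. now apply der.
  - intros [i [p [le_ic [Hp Hx]]]].
    destruct (fin_set_bounded (fun t => (exists z, fin_set p z /\ t = ⟨e, z⟩) /\
      derived dump_rule t)) as [w Hw].
    { apply bounded_incl with (fun t => exists z, fin_set p z /\ t = ⟨e, z⟩); [tauto |].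
      apply bounded_union; [apply bounded_fin_set | intros; apply bounded_eq]. }
    apply derived_intro with w; [intros t wt; now apply Hw |].
    unfold dump_rule. simp_pair. exists i, p. split; [exact le_ic |]. split; [| exact Hx].
    intros z pz. destruct (Hp z pz) as [lt [der|init]]; split; auto.
    left. apply Hw. split; [| exact der]. exists z. now rewrite pair_eta.
Qed.

Lemma dump_downward e c x y : x <= y -> dump e c y -> dump e c x.
Proof.
  rewrite !dump_iff. intros le_xy [i [p [le_ic [Hp Hy]]]]. exists i, p.
  split; [exact le_ic |]. split; [exact Hp |]. intros m lt. apply Hy. lia.
Qed.

Lemma dump_0 e c : dump e c 0.
Proof.
  apply dump_iff. exists 0, 0. split; [lia |]. split; [apply fin_set_0 | lia].
Qed.

Lemma coded_column_0 e y : coded e ⟨0, y⟩ <-> D y.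
Proof.
  unfold coded. simp_pair. split; [| auto]. intros [[_ Dy]|[k [N _]]]; [exact Dy | discriminate].
Qed.

Lemma coded_column_succ e k y :
  coded e ⟨S k, y⟩ <-> dump e k (S y) \/ (dump e k y /\ A k) \/ (initially e k y /\ A y).
Proof.
  unfold coded. simp_pair. split; [| eauto].
  intros [[N _]|[k' [E H]]]; [discriminate |]. now injection E as <-.
Qed.

Lemma coded_column_subset e k y : coded e ⟨S k, y⟩ -> dump e k y \/ initially e k y.
Proof.
  rewrite coded_column_succ. intros [H|[[H _]|[H _]]]; auto.
  left. revert H. apply dump_downward. lia.
Qed.

Hypothesis A_iff_witness : forall y, A y <-> exists a, A_wit y a.
Hypothesis guess_axiom_iff_witness : forall q t, guess_axiom q t <-> exists a, ax_wit ⟨q, t⟩ a.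
Hypothesis A_not_le_D : ~ A ≤ₑ D.

Lemma disagreement q : exists m, ~ agree q m.
Proof.
  apply not_all_ex_not. intro always. apply A_not_le_D.
  apply (adequate_ext (C := e_ideal D) (fun y => exists u, guess_axiom q ⟨y, u⟩)).
  - intro y. split.
    + intros [u Hu]. apply guess_axiom_iff_witness in Hu. destruct Hu as [a Ha].
      destruct (always ⟨⟨y, u⟩, a⟩) as [H _]. simp_pair. tauto.
    + intro Ay. pose proof Ay as Ha. apply A_iff_witness in Ha. destruct Ha as [a Ha].
      destruct (always ⟨⟨y, 0⟩, a⟩) as [_ H]. simp_pair. tauto.
  - pose proof e_ideal_guess_axiom. pointclass_tac.
Qed.

Lemma initially_bounded e k : (exists b, ~ X e k b) -> bounded (initially e k).
Proof.
  intro H. apply bounded_incl with (fun y => forall b, b < y -> X e k b).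
  - unfold initially. auto.
  - now apply bounded_initial.
Qed.

Lemma dump_bounded e c : (forall k, k < c -> exists b, ~ X e k b) -> bounded (dump e c).
Proof.
  induction c as [c IH] using lt_wf_ind. intro finite.
  assert (columns : bounded (fun z =>
    π1 z < c /\ (dump e (π1 z) (π2 z) \/ initially e (π1 z) (π2 z)))).
  { apply (bounded_pairs c (fun k y => dump e k y \/ initially e k y)). intros k lt.
    apply bounded_or; [| now apply initially_bounded, finite].
    apply IH; [exact lt |]. intros k' lt'. apply finite. lia. }
  apply bounded_incl with (fun x => exists i, i < S c /\ exists p,
    (p ⊆ fun z => π1 z < c /\ (dump e (π1 z) (π2 z) \/ initially e (π1 z) (π2 z))) /\
    forall m, m < x -> agree ⟨i, p⟩ m).
  - intros x Hx. apply dump_iff in Hx. destruct Hx as [i [p [le_ic Hx]]].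
    exists i. split; [lia | eauto].
  - apply bounded_union; [apply bounded_lt |]. intros i _.
    apply bounded_union; [now apply bounded_powerset |]. intros p _.
    apply bounded_initial, disagreement.
Qed.

Lemma coded_computes e : (exists k, forall b, X e k b) -> A ≤ₑ coded e.
Proof.
  intro H. apply least_witness in H. destruct H as [k [full least]].
  destruct (dump_bounded e k) as [n Hn].
  { intros j lt. apply not_all_ex_not. now apply least. }
  destruct (fin_set_bounded (fun y => y < n /\ A y)) as [u Hu]; [exists n; tauto |].
  apply (adequate_ext (C := e_ideal (coded e))
    (fun y => fin_set u y \/ (n <= y /\ coded e ⟨S k, y⟩))).
  - intro y. rewrite Hu, coded_column_succ. split.
    + intros [[_ Ay]|[le_ny [H|[[H _]|[_ Ay]]]]]; auto; apply Hn in H; lia.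
    + intro Ay. destruct (Nat.lt_ge_cases y n) as [|le_ny]; [auto |].
      right. split; [exact le_ny |]. right; right. split; [| exact Ay]. intros b _. apply full.
  - pointclass_tac.
Qed.

Lemma initial_columns_finite e i :
  (forall k, exists b, ~ X e k b) ->
  exists p, forall k y, fin_set p ⟨k, y⟩ <-> k < i /\ coded e ⟨S k, y⟩.
Proof.
  intro finite.
  destruct (fin_set_bounded (fun z => π1 z < i /\ coded e ⟨S (π1 z), π2 z⟩)) as [p Hp].
  { apply (bounded_pairs i (fun k y => coded e ⟨S k, y⟩)). intros k _.
    apply bounded_incl with (fun y => dump e k y \/ initially e k y).
    - apply coded_column_subset.
    - apply bounded_or; [now apply dump_bounded | now apply initially_bounded]. }
  exists p. intros k y. rewrite Hp. now simp_pair.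
Qed.

Section CorrectGuess.

Variables e i p : nat.
Hypothesis p_columns : forall k y, fin_set p ⟨k, y⟩ <-> k < i /\ coded e ⟨S k, y⟩.

Lemma coded_subset_guess v : coded e v -> guess ⟨i, p⟩ v.
Proof.
  rewrite <- (pair_eta v). unfold guess. destruct (π1 v) as [|k]; simp_pair; intro Hv.
  - left. split; [reflexivity |]. now apply coded_column_0 in Hv.
  - right. destruct (Nat.lt_ge_cases k i) as [lt|le]; [right | left; lia].
    exists k. split; [reflexivity |]. now apply p_columns.
Qed.

Lemma dump_beyond_guess c x :
  i <= c -> (forall m, m < x -> agree ⟨i, p⟩ m) -> dump e c x.
Proof.
  intros le_ic Hx. apply dump_iff. exists i, p. split; [exact le_ic |]. split; [| exact Hx].
  intros z pz. rewrite <- (pair_eta z) in pz. apply p_columns in pz. destruct pz as [lt Hz].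
  split; [lia | now apply coded_column_subset].
Qed.

Lemma guess_subset_coded v :
  (forall m, m <= π2 v -> agree ⟨i, p⟩ m) -> guess ⟨i, p⟩ v -> coded e v.
Proof.
  rewrite <- (pair_eta v). simp_pair. intro Hv. unfold guess. simp_pair.
  intros [[-> Dv]|[lt|[k [-> pv]]]].
  - now apply coded_column_0.
  - destruct (π1 v) as [|k]; [lia |]. apply coded_column_succ. left.
    apply dump_beyond_guess; [lia |]. intros m lt_m. apply Hv. lia.
  - now apply p_columns.
Qed.

(* A first disagreement at [y ∈ A] refutes A = e_op i (coded e) since the guess contains [coded e].
   A first disagreement at [y ∉ A] does so because the finite part of the guess that is used has
   elements below the disagreement, so it has been dumped into [coded e]. *)
Lemma e_op_coded_neq : ~ forall y, A y <-> e_op i (coded e) y.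
Proof.
  intro computes. destruct (least_witness _ (disagreement ⟨i, p⟩)) as [m [differ least]].
  rewrite <- (pair_eta m), <- (pair_eta (π1 m)) in differ, least.
  set (y := π1 (π1 m)) in *. set (u := π2 (π1 m)) in *. set (a := π2 m) in *. clearbody y u a.
  apply differ. unfold agree. simp_pair. split; apply NNPP; intro N; apply not_or_and in N.
  - destruct N as [wit nAy]. apply nAy, computes. apply NNPP in wit.
    assert (ax : guess_axiom ⟨i, p⟩ ⟨y, u⟩) by (apply guess_axiom_iff_witness; eauto).
    destruct ax as [Hu u_guess]. simp_pair. exists u. split; [| exact Hu].
    intros v uv. apply guess_subset_coded; [| now apply u_guess].
    intros n le. apply NNPP. apply least. apply fin_set_lt in uv.
    pose proof (pair_le (π1 v) (π2 v)) as le_v. rewrite pair_eta in le_v.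
    pose proof (pair_le y u). pose proof (pair_le ⟨y, u⟩ a). lia.
  - destruct N as [wit no_axiom]. apply NNPP in wit.
    assert (Ay : A y) by (apply A_iff_witness; eauto).
    apply computes in Ay. destruct Ay as [u' [u'_coded Hu']]. apply no_axiom. exists u'.
    split; simp_pair; [exact Hu' |]. intros v u'v. now apply coded_subset_guess, u'_coded.
Qed.

End CorrectGuess.

Lemma coded_not_computes e : (forall k, exists b, ~ X e k b) -> ~ A ≤ₑ coded e.
Proof.
  intros finite H. apply e_le_iff_e_op in H. destruct H as [i Hi].
  destruct (initial_columns_finite e i finite) as [p Hp]. exact (e_op_coded_neq e i p Hp Hi).
Qed.

Lemma coded_computes_iff e : A ≤ₑ coded e <-> exists k, forall b, X e k b.
Proof.
  split; [| apply coded_computes]. intro H. apply NNPP. intro none. revert H.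
  apply coded_not_computes. intro k. apply not_all_ex_not. eauto.
Qed.

Lemma e_le_coded e : D ≤ₑ coded e.
Proof.
  apply (adequate_ext (C := e_ideal (coded e)) (fun y => coded e ⟨0, y⟩)).
  - apply coded_column_0.
  - pointclass_tac.
Qed.

Lemma coded_recovers e k :
  (forall k b, ~ X e k b) -> A k <-> forall y, coded e ⟨S k, y⟩ \/ ~ dump e k y.
Proof.
  intro empty. split.
  - intros Ak y. destruct (classic (dump e k y)); [left | auto]. apply coded_column_succ. auto.
  - intro H. destruct (dump_bounded e k) as [n Hn]; [intros; exists 0; auto |].
    destruct (least_witness (fun y => ~ dump e k y)) as [y [ndump least]].
    { exists n. intro dumped. apply Hn in dumped. lia. }
    destruct y as [|y]; [now destruct (ndump (dump_0 e k)) |].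
    destruct (H y) as [Hy|nd]; [| now destruct (least y (Nat.lt_succ_diag_r y))].
    apply coded_column_succ in Hy. destruct Hy as [Hy|[[_ Ak]|[init _]]].
    + contradiction.
    + exact Ak.
    + destruct (empty k 0). apply init. lia.
Qed.

End Coding.

Lemma sigma2_witnesses A D :
  sigma2 A -> D ≤ₑ A ->
  exists A_wit ax_wit,
    co_class sigma1 (fun z => A_wit (π1 z) (π2 z)) /\ (forall y, A y <-> exists a, A_wit y a) /\
    co_class sigma1 (fun z => ax_wit (π1 z) (π2 z)) /\
    forall q t, guess_axiom D q t <-> exists a, ax_wit ⟨q, t⟩ a.
Proof.
  intros HA DA.
  assert (sigma2_axiom : sigma2 (fun z => guess_axiom D (π1 z) (π2 z))).
  { apply e_le_closed with D; [apply e_ideal_guess_axiom | now apply e_le_closed with A]. }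
  destruct HA as [A_wit [co_A_wit A_spec]], sigma2_axiom as [ax_wit [co_ax_wit ax_spec]].
  exists A_wit, ax_wit. do 3 (split; [assumption |]). exact (curry_iff _ _ ax_spec).
Qed.

Lemma intermediate_family A D S :
  sigma2 A -> D ≤ₑ A -> ~ A ≤ₑ D -> sigma3_in A S ->
  exists Z : nat -> nset,
    (fun z => Z (π1 z) (π2 z)) ≤ₑ A /\ forall e, D ≤ₑ Z e /\ (A ≤ₑ Z e <-> S e).
Proof.
  intros HA DA AD [P [[X [HX PX]] SP]].
  destruct (sigma2_witnesses A D HA DA) as [A_wit [ax_wit [co_A_wit [A_spec [co_ax_wit ax_spec]]]]].
  assert (XA : e_ideal A (fun z => X ⟨π1 z, π1 (π2 z)⟩ (π2 (π2 z)))).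
  { change (e_ideal A (fun z => X (π1 z) (π2 z))) in HX. pointclass_tac. }
  exists (coded A D (fun e k b => X ⟨e, k⟩ b) A_wit ax_wit). split.
  - apply e_ideal_coded; auto. now apply e_ideal_dump.
  - intro e. split; [apply e_le_coded |].
    rewrite coded_computes_iff; auto. rewrite SP.
    pose proof (curry_iff _ _ PX) as PX'. now setoid_rewrite PX'.
Qed.

(* With [X] empty, the columns of [coded] are finite, and column [k + 1] tells whether [k ∈ A] just
   beyond the part that is dumped. *)
Lemma intermediate_recovery A D :
  sigma2 A -> D ≤ₑ A -> ~ A ≤ₑ D ->
  exists Z, D ≤ₑ Z /\ Z ≤ₑ A /\ ~ A ≤ₑ Z /\ forall B, Z ≤ₑ B -> pi2_in B A.
Proof.
  intros HA DA AD.
  destruct (sigma2_witnesses A D HA DA) as [A_wit [ax_wit [co_A_wit [A_spec [co_ax_wit ax_spec]]]]].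
  set (X := fun _ _ _ : nat => False).
  assert (XA : e_ideal A (fun z => X (π1 z) (π1 (π2 z)) (π2 (π2 z)))) by apply e_le_empty.
  pose proof (e_ideal_dump A D X A_wit ax_wit DA XA co_A_wit co_ax_wit) as dump_A.
  pose proof (e_ideal_coded A D X A_wit ax_wit DA XA dump_A) as coded_A.
  assert (dump_sigma2 := e_le_closed (C := sigma2) _ A dump_A HA).
  exists (coded A D X A_wit ax_wit 0). split; [apply e_le_coded |]. split; [| split].
  - now apply (adequate_section (C := e_ideal A)).
  - apply coded_not_computes; auto. intro k. exists 0. auto.
  - set (L := dump A D X A_wit ax_wit) in *. set (Z := coded A D X A_wit ax_wit 0).
    intro B. change (Z ≤ₑ B) with (e_ideal B Z). intro ZB.
    apply (adequate_ext (fun k => forall y, Z ⟨S k, y⟩ \/ ~ L 0 k y)).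
    + intro k. symmetry. apply coded_recovers; auto.
    + apply all_closed, adequate_or.
      * apply all_class_incl. pointclass_tac.
      * apply (sigma2_co_all_class (C := e_ideal B)). pointclass_tac.
Qed.

(** * Relativized Ahmad pairs *)

Definition ahmad_pair (D A B : nset) : Prop :=
  D ≤ₑ A /\ D ≤ₑ B /\ ~ A ≤ₑ B /\ forall Z, D ≤ₑ Z -> Z ≤ₑ A -> A ≤ₑ Z \/ Z ≤ₑ B.

Lemma ahmad_pair_proper D A B : ahmad_pair D A B -> ~ A ≤ₑ D.
Proof. intros [_ [DB [AB _]]] AD. apply AB. now apply e_le_trans with D. Qed.

Lemma ahmad_pair_left_pi2_in D A B : sigma2 A -> ahmad_pair D A B -> pi2_in B A.
Proof.
  intros HA pair. pose proof pair as [DA [_ [_ between]]].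
  destruct (intermediate_recovery A D HA DA (ahmad_pair_proper D A B pair))
    as [Z [DZ [ZA [AZ recover]]]].
  apply recover. destruct (between Z DZ ZA); [contradiction | assumption].
Qed.

Lemma ahmad_pair_below_pi2_in D A B Z : sigma2 A -> ahmad_pair D A B -> Z ≤ₑ A -> pi2_in B Z.
Proof.
  intros HA [DA [DB [AB between]]] ZA.
  pose proof (e_join_lub Z D A ZA DA) as JA.
  destruct (between (e_join Z D) (e_join_r Z D) JA) as [AJ|JB].
  - apply (adequate_ext (fun x => e_join Z D ⟨0, x⟩)).
    { intro x. unfold e_join. simp_pair. intuition discriminate. }
    apply adequate_comp; [| recursive_tac]. apply ahmad_pair_left_pi2_in with D.
    + now apply e_le_closed with A.
    + split; [apply e_join_r |]. split; [exact DB |]. split.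
      * intro JB. apply AB. now apply e_le_trans with (e_join Z D).
      * intros Y DY YJ. destruct (between Y DY) as [AY|YB]; [| | auto].
        -- now apply e_le_trans with (e_join Z D).
        -- left. now apply e_le_trans with A.
  - apply all_class_incl. apply e_le_trans with (e_join Z D); [apply e_join_l | exact JB].
Qed.

Lemma ahmad_pair_coding D A B S :
  sigma2 A -> ahmad_pair D A B -> sigma3_in A S ->
  exists Z : nat -> nset,
    (fun z => Z (π1 z) (π2 z)) ≤ₑ A /\
    forall e, ~ S e <-> exists j, forall x, Z e x <-> e_op j B x.
Proof.
  intros HA pair HS. pose proof pair as [DA [_ [AB between]]].
  destruct (intermediate_family A D S HA DA (ahmad_pair_proper D A B pair) HS) as [Z [ZA HZ]].
  exists Z. split; [exact ZA |]. intro e. destruct (HZ e) as [DZ AZ].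
  rewrite <- AZ, <- e_le_iff_e_op. split.
  - intro nAZ. destruct (between (Z e) DZ); [| contradiction | assumption].
    now apply (adequate_section (C := e_ideal A)).
  - intros ZB AZ'. apply AB. now apply e_le_trans with (Z e).
Qed.

Lemma sigma2_e_op B : sigma2 B -> sigma2 (fun z => e_op (π1 z) B (π2 z)).
Proof. apply e_le_closed, e_ideal_e_op. Qed.

Lemma ahmad_pair_left_sigma4 D A B S :
  sigma2 A -> sigma2 B -> ahmad_pair D A B -> sigma3_in A S -> co_class sigma4 S.
Proof.
  intros HA HB pair HS. destruct (ahmad_pair_coding D A B S HA pair HS) as [Z [ZA HZ]].
  exists (fun e j => forall x, Z e x <-> e_op j B x). split; [| exact HZ].
  assert (sigma2_Z : sigma2 (fun z => Z (π1 z) (π2 z))) by now apply e_le_closed with A.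
  pose proof (sigma2_e_op B HB) as sigma2_U.
  now apply (all_class_equal_sections Z (fun j => e_op j B)); try apply all_class_incl.
Qed.

Lemma ahmad_pair_right_sigma3 D A B S :
  sigma2 A -> sigma2 B -> ahmad_pair D A B -> pi3 S -> sigma3_in B S.
Proof.
  intros HA HB pair HS.
  destruct (ahmad_pair_coding D A B (fun x => ~ S x) HA pair) as [Z [ZA HZ]].
  { now apply pi3_co_sigma3_in. }
  exists (fun e j => forall x, Z e x <-> e_op j B x).
  split; [| intro e; rewrite <- HZ; split; [tauto | apply NNPP]].
  apply (all_class_equal_sections Z (fun j => e_op j B)).
  - now apply e_le_closed with A.
  - exact (ahmad_pair_below_pi2_in D A B _ HA pair ZA).
  - now apply sigma2_e_op.
  - apply all_class_incl, e_ideal_e_op.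
Qed.

Theorem no_ahmad_chain D0 A0 B0 D1 A1 B1 :
  sigma2 A0 -> sigma2 B0 -> sigma2 A1 -> sigma2 B1 ->
  ahmad_pair D0 A0 B0 -> ahmad_pair D1 A1 B1 -> ~ B0 ≤ₑ A1.
Proof.
  intros HA0 HB0 HA1 HB1 pair0 pair1 B0A1.
  destruct sigma4_not_closed_under_complement as [S [HS co_S]]. apply co_S.
  apply (ahmad_pair_left_sigma4 D1 A1 B1); auto.
  apply sigma3_in_mono with B0; [exact B0A1 |].
  apply sigma4_sigma3_in; [| exact HS]. intros P HP. now apply ahmad_pair_right_sigma3 with D0 A0.
Qed.

Definition avoiding (D A : nset) (L : list nset) (Z : nset) : Prop :=
  D ≤ₑ Z /\ Z <ₑ A /\ forall B, In B L -> ~ Z ≤ₑ B.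

(* Unless [(A, B)] is an Ahmad pair above [D], the set [D] can be raised to one that is not below
   [B]; this disposes of the members [B] of [L] one by one. *)
Lemma ahmad_pair_of_not_avoiding A L :
  (forall B, In B L -> ~ A ≤ₑ B) ->
  forall D, D ≤ₑ A -> ~ A ≤ₑ D -> (forall Z, ~ avoiding D A L Z) ->
  exists B D', In B L /\ D ≤ₑ D' /\ ahmad_pair D' A B.
Proof.
  induction L as [|B L IH]; intros AL D DA AD none.
  - destruct (none D). split; [apply e_le_refl |]. split; [now split | intros ? []].
  - destruct (classic (exists Y, D ≤ₑ Y /\ Y ≤ₑ A /\ ~ A ≤ₑ Y /\ ~ Y ≤ₑ B))
      as [[Y [DY [YA [AY YB]]]]|no_Y].
    + destruct (IH (fun B' BL => AL B' (or_intror BL)) Y YA AY) as [B' [D' [B'L [YD' pair]]]].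
      * intros Z [YZ [ZA ZL]]. apply (none Z).
        split; [now apply e_le_trans with Y |]. split; [exact ZA |].
        intros B' [<-|B'L]; [| now apply ZL]. intro ZB. apply YB. now apply e_le_trans with Z.
      * exists B', D'. split; [now right |]. split; [now apply e_le_trans with Y | exact pair].
    + assert (between : forall Z, D ≤ₑ Z -> Z ≤ₑ A -> A ≤ₑ Z \/ Z ≤ₑ B).
      { intros Z DZ ZA. apply NNPP. intro N. apply no_Y. exists Z. tauto. }
      exists B, D. split; [now left |]. split; [apply e_le_refl |].
      split; [exact DA |]. split; [| split; [apply AL; now left | exact between]].
      destruct (between D (e_le_refl D) DA); [contradiction | assumption].
Qed.

Theorem avoiding_dichotomy D0 A0 L0 D1 A1 L1 :
  Sigma02 A0 -> Sigma02 A1 -> (forall B, In B (L0 ++ L1) -> Sigma02 B) ->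
  D0 ≤ₑ A0 -> ~ A0 ≤ₑ D0 -> (forall B, In B L0 -> ~ A0 ≤ₑ B) ->
  D1 ≤ₑ A1 -> ~ A1 ≤ₑ D1 -> (forall B, In B L1 -> ~ A1 ≤ₑ B) ->
  (forall B, In B L0 -> D0 ≤ₑ B -> B ≤ₑ A1) ->
  exists Z, Sigma02 Z /\ (avoiding D0 A0 L0 Z \/ avoiding D1 A1 L1 Z).
Proof.
  intros HA0 HA1 HL DA0 AD0 AL0 DA1 AD1 AL1 link. apply NNPP. intro none.
  assert (below : forall A Z, Sigma02 A -> Z <ₑ A -> Sigma02 Z).
  { intros A Z HA [ZA _]. apply sigma2_iff_Sigma02 in HA. apply sigma2_iff_Sigma02.
    now apply e_le_closed with A. }
  destruct (ahmad_pair_of_not_avoiding A0 L0 AL0 D0 DA0 AD0) as [B0 [D0' [BL0 [DD0 pair0]]]].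
  { intros Z HZ. apply none. exists Z. split; [apply (below A0 Z HA0), HZ | auto]. }
  destruct (ahmad_pair_of_not_avoiding A1 L1 AL1 D1 DA1 AD1) as [B1 [D1' [BL1 [DD1 pair1]]]].
  { intros Z HZ. apply none. exists Z. split; [apply (below A1 Z HA1), HZ | auto]. }
  apply (no_ahmad_chain D0' A0 B0 D1' A1 B1); auto; try apply sigma2_iff_Sigma02; auto.
  - apply HL, in_or_app. auto.
  - apply HL, in_or_app. auto.
  - apply link; [exact BL0 |]. apply e_le_trans with D0'; [exact DD0 | apply pair0].
Qed.

Lemma exists_under_hypothesis (H : Prop) (P : nset -> Prop) :
  (exists Z, Sigma02 Z) -> (H -> exists Z, Sigma02 Z /\ P Z) -> exists Z, Sigma02 Z /\ (H -> P Z).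
Proof.
  intros [Z HZ] K. destruct (classic H) as [h|nh].
  - destruct (K h) as [Z' [HZ' PZ']]. eauto.
  - exists Z. tauto.
Qed.

Lemma pairwise_incomparable_cons X l :
  pairwise_incomparable (X :: l) ->
  (forall Y, In Y l -> e_incomparable X Y) /\ pairwise_incomparable l.
Proof.
  intro H. inversion H as [|? ? Xl Hl]. split; [now apply Forall_forall | exact Hl].
Qed.

Lemma in_upto F n X : In X (upto F n) <-> exists i, i <= n /\ F i = X.
Proof.
  unfold upto. rewrite in_map_iff. split.
  - intros [i [<- Hi]]. apply in_seq in Hi. exists i. split; [lia | reflexivity].
  - intros [i [le <-]]. exists i. split; [reflexivity |]. apply in_seq. lia.
Qed.

Corollary avoiding_pair_dichotomy D0 A0 B0 D1 A1 B1 :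
  Sigma02 A0 -> Sigma02 B0 -> Sigma02 A1 -> Sigma02 B1 ->
  D0 ≤ₑ A0 -> D0 ≤ₑ B0 -> ~ A0 ≤ₑ B0 -> D1 ≤ₑ A1 -> D1 ≤ₑ B1 -> ~ A1 ≤ₑ B1 -> B0 ≤ₑ A1 ->
  exists Z, Sigma02 Z /\
    ((D0 ≤ₑ Z /\ Z <ₑ A0 /\ ~ Z ≤ₑ B0) \/ (D1 ≤ₑ Z /\ Z <ₑ A1 /\ ~ Z ≤ₑ B1)).
Proof.
  intros HA0 HB0 HA1 HB1 DA0 DB0 AB0 DA1 DB1 AB1 link.
  destruct (avoiding_dichotomy D0 A0 [B0] D1 A1 [B1]) as [Z [HZ av]]; auto;
    try now intros B [<-|[]].
  - now intros B [<-|[<-|[]]].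
  - intro AD0. apply AB0. now apply e_le_trans with D0.
  - intro AD1. apply AB1. now apply e_le_trans with D1.
  - exists Z. split; [exact HZ |].
    destruct av as [[DZ [ZA ZL]]|[DZ [ZA ZL]]]; [left | right];
      (split; [exact DZ | split; [exact ZA | apply ZL; now left]]).
Qed.

Lemma upto_avoiding_dichotomy (n m : nat) (Ahat A : nset) (B C : nat -> nset) :
  Sigma02 A -> (forall i, i <= n -> Sigma02 (B i)) -> (forall i, i <= m -> Sigma02 (C i)) ->
  Ahat ≤ₑ A -> Ahat ≤ₑ B 0 -> (forall i, i <= n -> i <> 0 -> ~ Ahat ≤ₑ B i) ->
  pairwise_incomparable (A :: upto B n ++ upto C m) ->
  exists Z, Sigma02 Z /\
    (avoiding Ahat A (upto B n) Z \/ avoiding (fun _ => False) (B 0) (upto C m) Z).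
Proof.
  intros HA HB HC hatA hatB hat_only incomp.
  apply pairwise_incomparable_cons in incomp. destruct incomp as [A_incomp incomp].
  change (upto B n ++ upto C m) with (B 0 :: map B (seq 1 n) ++ upto C m) in incomp.
  apply pairwise_incomparable_cons in incomp. destruct incomp as [B_incomp _].
  assert (AB : forall X, In X (upto B n) -> ~ A ≤ₑ X).
  { intros X BX. apply A_incomp, in_or_app. now left. }
  assert (BC : forall X, In X (upto C m) -> ~ B 0 ≤ₑ X).
  { intros X CX. apply B_incomp, in_or_app. now right. }
  apply avoiding_dichotomy; auto using e_le_empty with arith.
  - intros X BCX. rewrite in_app_iff, !in_upto in BCX.
    destruct BCX as [[i [le <-]]|[i [le <-]]]; auto.
  - intro A_hat. apply (AB (B 0)); [now left | now apply e_le_trans with Ahat].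
  - intro B_empty. apply (BC (C 0)); [now left |].
    now apply e_le_trans with (fun _ => False); [| apply e_le_empty].
  - intros X BX hatX. apply in_upto in BX. destruct BX as [i [le <-]].
    destruct (Nat.eq_dec i 0) as [->|i_neq0]; [apply e_le_refl |].
    now destruct (hat_only i le i_neq0).
Qed.

Theorem theorem7p1 :
  (forall A0 B0 A1 B1 : nset,
     Sigma02 A0 -> Sigma02 B0 -> Sigma02 A1 -> Sigma02 B1 ->
     exists Z : nset, Sigma02 Z /\
       (B0 ≤ₑ A1 /\ ~ A0 ≤ₑ B0 /\ ~ A1 ≤ₑ B1 ->
        (Z <ₑ A0 /\ ~ Z ≤ₑ B0) \/ (Z <ₑ A1 /\ ~ Z ≤ₑ B1)))
  /\
  (forall (n m : nat) (Ahat A : nset) (B C : nat -> nset),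
     Sigma02 Ahat -> Sigma02 A ->
     (forall i, i <= n -> Sigma02 (B i)) ->
     (forall i, i <= m -> Sigma02 (C i)) ->
     exists Z : nset, Sigma02 Z /\
       (Ahat ≤ₑ A /\ Ahat ≤ₑ B 0 /\
        (forall i, i <= n -> i <> 0 -> ~ Ahat ≤ₑ B i) /\
        pairwise_incomparable (A :: upto B n ++ upto C m) ->
        (Z <ₑ A /\ forall i, i <= n -> ~ Z ≤ₑ B i) \/
        (Z <ₑ B 0 /\ forall i, i <= m -> ~ Z ≤ₑ C i)))
  /\
  (forall A B C D0 D1 : nset,
     Sigma02 A -> Sigma02 B -> Sigma02 C -> Sigma02 D0 -> Sigma02 D1 ->
     exists Z : nset, Sigma02 Z /\
       (pairwise_incomparable [A; B; C] /\
        D0 <ₑ A /\ D0 <ₑ B /\ D1 <ₑ B /\ D1 <ₑ C ->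
        (D0 <ₑ Z /\ Z <ₑ A /\ ~ Z ≤ₑ B) \/
        (D1 <ₑ Z /\ Z <ₑ B /\ ~ Z ≤ₑ C))).
Proof.
  split; [| split].
  - intros A0 B0 A1 B1 HA0 HB0 HA1 HB1. apply exists_under_hypothesis; [eauto |].
    intros [link [AB0 AB1]].
    destruct (avoiding_pair_dichotomy (fun _ => False) A0 B0 (fun _ => False) A1 B1)
      as [Z [HZ av]]; auto using e_le_empty.
    exists Z. tauto.
  - intros n m Ahat A B C _ HA HB HC. apply exists_under_hypothesis; [eauto |].
    intros [hatA [hatB [hat_only incomp]]].
    destruct (upto_avoiding_dichotomy n m Ahat A B C) as [Z [HZ av]]; auto.
    exists Z. split; [exact HZ |].
    destruct av as [[_ [ZA ZB]]|[_ [ZB ZC]]]; [left | right]; split; auto;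
      intros i le; [apply ZB | apply ZC]; apply in_upto; eauto.
  - intros A B C D0 D1 HA HB HC _ _. apply exists_under_hypothesis; [eauto |].
    intros [incomp [[DA0 _] [[DB0 _] [[DB1 _] [DC1 _]]]]].
    apply pairwise_incomparable_cons in incomp. destruct incomp as [A_incomp incomp].
    apply pairwise_incomparable_cons in incomp. destruct incomp as [B_incomp _].
    destruct (avoiding_pair_dichotomy D0 A B D1 B C) as [Z [HZ av]]; auto using e_le_refl.
    + apply A_incomp. now left.
    + apply B_incomp. now left.
    + exists Z. split; [exact HZ |].
      destruct av as [[DZ [ZA ZB]]|[DZ [ZB ZC]]]; [left | right];
        split; eauto using e_lt_of_not_e_le.
Qed.
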